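(* Let $\alpha=1$ and let $D\subset\mathbb{R}$ be any bounded open interval. Then there exist $\lambda>0$ and a solution $(u,K)$ of the interior Bernoulli problem for $(-\Delta)^{1/2}$ on $D$ with parameter $\lambda$ such that $u$ is not a solution of the corresponding variational problem (for $\alpha=1$, the same $\lambda$ and $D$).
   Context: The fractional Laplacian of order $\alpha=1$ on $\mathbb{R}$ is $$(-\Delta)^{1/2}f(x) = \lim_{\varepsilon \to 0^+} \frac{1}{\pi}\int_{\{z\in\mathbb{R}:\,|z|>\varepsilon\}}\frac{f(x+z)-f(x)}{|z|^{2}}\,dz .$$ Interior Bernoulli problem ($d=1$, $\alpha=1$): given a bounded open interval $D\subset\mathbb{R}$ and $\lambda>0$, a solution is a pair $(u,K)$ where $u:\mathbb{R}\to[0,1]$ is continuous and $K\subset D$ is a domain of class $C^1$ (in dimension one: an open interval) such that $(-\Delta)^{1/2}u(x)=0$ for $x\in D\setminus\overline{K}$; $u(x)=1$ for $x\in\overline{K}$; $u(x)=0$ for $x\in D^c=\mathbb{R}\setminus D$; $D_n^{1/2}u(x)=-\lambda$ for $x\in\partial K$, where $D_n^{1/2}u(x)=\lim_{t\to0^+}\frac{u(x+t\,n(x))-u(x)}{t^{1/2}}$ and $n(x)$ is the outward unit normal to $K$ at $x$. Variational problem ($d=1$, $\alpha=1$): given $\lambda>0$ and a bounded open interval $D$, find a nontrivial (not identically zero) minimizer $u\in H^{1/2}(\mathbb{R})$ of $$i_{1,\lambda,D}(u)=\frac{1}{2\pi}\iint_{\mathbb{R}\times\mathbb{R}}\frac{(u(x)-u(y))^2}{|x-y|^2}\,dx\,dy+\left(\Gamma(3/2)\right)^2\lambda^2\,|\{x\in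 D:\,u(x)<1\}|$$ subject to the constraint $u=0$ on $D^c$, where $|\cdot|$ denotes Lebesgue measure. *)

(* Defs.v *)
From mathcomp Require Import all_boot all_order all_algebra.
From mathcomp Require Import all_classical all_reals all_analysis.
Import Order.TTheory GRing.Theory Num.Theory.
Import numFieldNormedType.Exports.

Set Implicit Arguments.
Unset Strict Implicit.
Unset Printing Implicit Defensive.

Local Open Scope classical_set_scope.
Local Open Scope ring_scope.

Definition bounded_open_interval (R : realType) (A : set R) : Prop :=
  exists a b : R, a < b /\ A = `]a, b[%classic.

Definition Gamma (R : realType) (s : R) : R :=
  \int[@lebesgue_measure R]_(t in `]0, +oo[) (t `^ (s - 1) * expR (- t)).

(* The truncated integral is extended-real valued, so convergence to the real
   number l also says that it is finite for all small eps. *)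
Definition half_laplacian (R : realType) (f : R -> R) (x l : R) : Prop :=
  ((pi^-1)%:E * \int[@lebesgue_measure R]_(z in [set z : R | (eps < `|z|)%R])
     ((f (x + z) - f x) / `|z| ^+ 2)%:E)%E @[eps --> (0 : R)^'+] --> l%:E.

Definition boundary (T : topologicalType) (A : set T) : set T :=
  closure A `\` interior A.

Definition outward_unit_normal (R : realType) (K : set R) (x n : R) : Prop :=
  `|n| = 1 /\ \forall t \near (0 : R)^'+, K (x - t * n) /\ ~ K (x + t * n).

Definition half_normal_derivative (R : realType) (u : R -> R) (x n l : R) :
    Prop :=
  (u (x + t * n) - u x) / Num.sqrt t @[t --> (0 : R)^'+] --> l.

Record interior_Bernoulli_solution (R : realType) (D : set R) (lambda : R)
    (u : R -> R) (K : set R) : Prop := InteriorBernoulliSolution {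
  Bernoulli_continuous : continuous u ;
  Bernoulli_range : forall x, 0 <= u x <= 1 ;
  Bernoulli_K_domain : bounded_open_interval K ;
  Bernoulli_K_sub : K `<=` D ;
  Bernoulli_harmonic : forall x, D x -> ~ closure K x -> half_laplacian u x 0 ;
  Bernoulli_K : forall x, closure K x -> u x = 1 ;
  Bernoulli_outside : forall x, ~ D x -> u x = 0 ;
  Bernoulli_boundary : forall x n, boundary K x -> outward_unit_normal K x n ->
    half_normal_derivative u x n (- lambda) }.

(* The integrand on the diagonal, a null set, is 0 since x / 0 = 0. *)
Definition Gagliardo (R : realType) (u : R -> R) : \bar R :=
  (\int[@lebesgue_measure R \x @lebesgue_measure R]_z
     ((u z.1 - u z.2) ^+ 2 / `|z.1 - z.2| ^+ 2)%:E)%E.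

Definition H_half (R : realType) (u : R -> R) : Prop :=
  u \in Lfun (@lebesgue_measure R) 2%:E /\ (Gagliardo u < +oo)%E.

Definition energy (R : realType) (lambda : R) (D : set R) (u : R -> R) :
    \bar R :=
  (((2 * pi)^-1)%:E * Gagliardo u +
   (Gamma (3 / 2) ^+ 2 * lambda ^+ 2)%:E *
     @lebesgue_measure R [set x | D x /\ (u x < 1)%R])%E.

(* Elements of H^{1/2} are represented by functions, so the pointwise
   conditions on them are imposed almost everywhere. *)
Definition admissible (R : realType) (D : set R) (u : R -> R) : Prop :=
  H_half u /\ {ae @lebesgue_measure R, forall x, ~ D x -> u x = 0}.

Definition variational_solution (R : realType) (lambda : R) (D : set R)
    (u : R -> R) : Prop :=
  [/\ admissible D u,
      ~ {ae @lebesgue_measure R, forall x, u x = 0} &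
      forall v, admissible D v -> (energy lambda D u <= energy lambda D v)%E].

(* Main.v *)
Require Import Defs.
From mathcomp Require Import all_boot all_order all_algebra.
From mathcomp Require Import all_classical all_reals all_analysis.
From mathcomp Require Import measurable_realfun.
From mathcomp Require Import ring lra.
Import Order.TTheory GRing.Theory Num.Theory.
Import numFieldNormedType.Exports.
Local Open Scope classical_set_scope.
Local Open Scope ring_scope.

(** Let D = (c - rho, c + rho) and K = (c - r, c + r). With
    p(y) = sqrt(y^2 - r^2) and q(y) = sqrt(rho^2 - y^2), the condenser potential
    u is the even function (of the distance to c) equal to 1 on K, to 0 off D,
    and with u' = - kappa / (p q) on (r, rho). It solves the Bernoulli problem
    for lambda = 2 kappa / (sqrt(2 r) q(r)): pairing y with -y, the kernel
    1/(y-x)^2 + 1/(y+x)^2 is the derivative of k(y) = - 2 y / (y^2 - x^2), and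
    u' k has the elementary primitive
    - (kappa / (p(x) q(x))) log |(p(y) q(x) + p(x) q(y)) / (p(y) q(x) - p(x) q(y))|,
    whose singularity at x is even, so that the principal value vanishes.

    For r small u is not a minimizer, since 0 has less energy. The measure term
    gains Gamma(3/2)^2 lambda^2 2r = O(kappa^2 / rho^2), whereas u falls by at
    least kappa / (2 rho) between x and 2 x for r < x < rho / 3, so every dyadic
    scale contributes the same amount to the Gagliardo seminorm, which is
    therefore at least of order (kappa / rho)^2 log (rho / (3 r)). *)

Set Implicit Arguments.
Unset Strict Implicit.
Unset Printing Implicit Defensive.

(** * Calculus on the real line *)

Lemma is_derive_continuous (R : realType) (F : R -> R) (x l : R) :
  is_derive x 1 F l -> {for x, continuous F}.
Proof.
by move=> dF; apply/differentiable_continuous/derivable1_diffP; exact: ex_derive.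
Qed.

Lemma cvg_sqr (R : realType) (T : Type) (F : set_system T) (f : T -> R) (l : R) :
  Filter F -> f x @[x --> F] --> l -> f x ^+ 2 @[x --> F] --> l ^+ 2.
Proof.
move=> FF fl; rewrite expr2; under eq_fun do rewrite expr2.
exact: cvgM.
Qed.

(** L'Hopital's rule turns the limit of [g] at [c] into that of the difference quotients of [F].
    This recovers the derivative where formulas are glued, at [0], [r] and [rho]. *)
Lemma is_derive_removable (R : realType) (F g : R -> R) (a b c : R) :
  c \in `]a, b[ -> {for c, continuous F} -> {for c, continuous g} ->
  (forall y, y \in `]a, b[ -> y != c -> is_derive y 1 F (g y)) ->
  is_derive c 1 F (g c).
Proof.
move=> cab Fc gc dF.
have dB y : y \in `]a, b[ `\ c -> is_derive y 1 (fun t => F t - F c) (g y).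
  rewrite inE/= => -[yab /eqP yc].
  have dFy := dF _ yab yc.
  have -> : (fun t => F t - F c) = F - cst (F c) by [].
  by apply: is_derive_eq; rewrite subr0.
have dI y : y \in `]a, b[ `\ c -> is_derive y 1 (fun t => t - c) 1.
  move=> _; have -> : (fun t => t - c) = id - cst c by [].
  by apply: is_derive_eq; rewrite subr0.
have F0 : (F x - F c) @[x --> c] --> 0.
  rewrite -(subrr (F c)); apply: cvgB; [exact: Fc | exact: cvg_cst].
have I0 : (x - c) @[x --> c] --> 0.
  rewrite -[X in _ --> X](subrr c); apply: cvgB; [exact: cvg_id | exact: cvg_cst].
have D1 : g x / 1 @[x --> c] --> g c.
  by under eq_fun do rewrite divr1; exact: gc.
have := @lhopital R _ g _ (fun=> 1) a b c (g c) cab dB dI F0 I0 (fun _ _ => oner_neq0 _) D1.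
move=> lim.
apply/is_derive1_caratheodory.
exists (fun z => if z == c then g c else (F z - F c) / (z - c)); split.
- move=> z; case: eqP => [->|/eqP zc]; first by rewrite !subrr mulr0.
  by rewrite divfK// subr_eq0.
- apply/continuous_withinNx; rewrite eqxx.
  apply: cvg_trans lim; apply: near_eq_cvg; near=> z.
  by rewrite ifF//; apply/negbTE; near: z; exact: nbhs_dnbhs_neq.
- by rewrite eqxx.
Unshelve. all: by end_near. Qed.

(* The integrals from [-1] of [w] and of its reflection are glued at [0]. *)
Lemma continuous_has_primitive (R : realType) (w : R -> R) :
  continuous w -> exists W : R -> R, forall y : R, is_derive y 1 W (w y).
Proof.
have half (v : R -> R) : continuous v ->
    exists A : R -> R, forall y : R, -1 < y -> is_derive y 1 A (v y).
  move=> cv.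
  (* Starting the integral at [-1] makes [0] an interior point, so both halves are differentiable,
     hence continuous, at the gluing point. *)
  exists (fun y => \int[@lebesgue_measure R]_(t in `[-1, y]) v t)%R => y y1.
  have yy : y < y + 1 by rewrite ltrDl.
  have iv : (@lebesgue_measure R).-integrable `[-1, y + 1] (EFin \o v).
    apply: continuous_compact_integrable; first exact: segment_compact.
    exact: continuous_subspaceT.
  have [dv v'] := continuous_FTC1_closed yy iv y1 (cv y).
  by rewrite -v' derive1E; exact/derivableP.
move=> cw.
have [A dA] := half w cw.
have cwN : continuous (w \o -%R).
  by move=> y; apply: continuous_comp; [exact: opp_continuous | exact: cw].
have [B dB] := half _ cwN.
pose P y := A y - A 0; pose Q y := - (B (- y) - B 0).
have dP (y : R) : -1 < y -> is_derive y 1 P (w y).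
  move=> y1; have := dA _ y1 => ?.
  have -> : P = A - cst (A 0) by [].
  by apply: is_derive_eq; rewrite subr0.
have dQ (y : R) : y < 1 -> is_derive y 1 Q (w y).
  move=> y1.
  have dBy : is_derive (- y) 1 B (w y) by rewrite -{2}[y]opprK; apply: dB; lra.
  have -> : Q = - (B \o -%R - cst (B 0)) by [].
  by apply: is_derive_eq; rewrite subr0 mulrN1 opprK.
pose W y := if 0 <= y then P y else Q y.
exists W => y.
have dW (z : R) : z != 0 -> is_derive z 1 W (w z).
  rewrite neq_lt => /orP[z0|z0].
    apply: (@near_eq_is_derive _ _ _ Q); last by apply: dQ; lra.
    near=> t; rewrite /W ifF//; apply/negbTE; rewrite -ltNge.
    by near: t; exact: lt_nbhsl.
  apply: (@near_eq_is_derive _ _ _ P); last by apply: dP; lra.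
  near=> t; rewrite /W ifT//; apply: ltW.
  by near: t; exact: lt_nbhsr.
have [->|/dW//] := eqVneq y 0.
apply: (@is_derive_removable R W w (-1) 1) => //; first by rewrite in_itv/=; lra.
- have cont (F : R -> R) : is_derive (0 : R) 1 F (w 0) -> F 0 = 0 -> F t @[t --> 0] --> W 0.
    move=> dF F0; have -> : W 0 = F 0 by rewrite /W lexx /P subrr F0.
    by apply/differentiable_continuous/derivable1_diffP; exact: ex_derive.
  have cP : P t @[t --> 0] --> W 0 by apply: cont; [apply: dP; lra | rewrite /P subrr].
  have cQ : Q t @[t --> 0] --> W 0.
    by apply: cont; [apply: dQ; lra | rewrite /Q oppr0 subrr oppr0].
  apply/cvgrPdist_lt => e e0.
  move/cvgrPdist_lt : cP => /(_ _ e0) cP; move/cvgrPdist_lt : cQ => /(_ _ e0) cQ.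
  near=> t; rewrite {2}/W; case: ifP => _; by near: t.
- exact: cw.
Unshelve. all: by end_near. Qed.

(** Inversion is continuous away from [0], and a single point does not affect measurability. This
    serves the singular kernels of the half-Laplacian and of the seminorm. *)
Lemma measurable_inv (R : realType) : measurable_fun [set: R] (fun x : R => x^-1).
Proof.
rewrite -(setvU [set 0]); apply/measurable_funU.
- exact: measurableC.
- exact: measurable_set1.
split; last exact: measurable_fun_set1.
apply: open_continuous_measurable_fun.
  by apply: closed_openC; exact/accessible_closed_set1/hausdorff_accessible/Rhausdorff.
move=> x; rewrite inE/= => /eqP x0; exact: inv_continuous.
Qed.

Lemma integral_inv_sqr_right (R : realType) (a c : R) : 0 < a -> 0 <= c ->
  (\int[@lebesgue_measure R]_(z in `[a, +oo[) (c / z ^+ 2)%:E = (c / a)%:E)%E.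
Proof.
move=> a0 c0.
have dF (z : R) : a <= z -> is_derive z 1 (fun z => - (c / z)) (c / z ^+ 2).
  move=> az; have z0 : z != 0 by rewrite gt_eqF// (lt_le_trans a0).
  have dV : is_derive z 1 (fun y : R => y^-1) (- z ^- 2 *: 1).
    exact: (@is_deriveV R id z 1 1).
  have -> : (fun z => - (c / z)) = (- c) \*: (fun y : R => y^-1).
    by apply/funext => t /=; rewrite -mulNr.
  by apply: is_derive_eq; rewrite /GRing.scale/= mulr1 mulrNN.
rewrite (@ge0_continuous_FTC2y R (fun z => c / z ^+ 2) (fun z => - (c / z)) a 0).
- by rewrite -EFinB sub0r opprK.
- by move=> z az; rewrite divr_ge0// sqr_ge0.
- apply: continuous_in_subspaceT => z; rewrite inE/= in_itv/= andbT => az.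
  apply: cvgM; first exact: cvg_cst.
  apply: cvgV; last exact: exprn_continuous.
  by rewrite expf_neq0// gt_eqF// (lt_le_trans a0).
- rewrite -[X in _ --> X]oppr0 -(mulr0 c); apply: cvgN; apply: cvgM; first exact: cvg_cst.
  apply/gtr0_cvgV0; last exact: cvg_id.
  by near=> z; near: z; exact: nbhs_pinfty_gt.
- by move=> z /ltW /dF dz; exact: ex_derive.
- apply: cvg_at_right_filter. exact: (is_derive_continuous (dF _ (lexx a))).
- move=> z; rewrite in_itv/= andbT => /ltW /dF dz.
  by rewrite derive1E; exact: derive_val.
Unshelve. all: by end_near. Qed.

Lemma integral_inv_sqr_left (R : realType) (a c : R) : 0 < a -> 0 <= c ->
  (\int[@lebesgue_measure R]_(z in `]-oo, (- a)%R]) (c / z ^+ 2)%:E = (c / a)%:E)%E.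
Proof.
move=> a0 c0.
rewrite (@ge0_integration_by_substitutionNy R (fun z => c / z ^+ 2)).
- rewrite -integral_inv_sqr_right//; apply: eq_integral => z _ /=.
  by rewrite sqrrN.
- apply: continuous_in_subspaceT => z; rewrite inE/= in_itv/= => az.
  apply: cvgM; first exact: cvg_cst.
  apply: cvgV; last exact: exprn_continuous.
  by rewrite expf_neq0// lt_eqF// (le_lt_trans az)// oppr_lt0.
- by move=> z _; rewrite divr_ge0// sqr_ge0.
Qed.

(** On the two bounded pieces the fundamental theorem of calculus will apply, and on the two tails
    the integrand will be a multiple of [1 / z ^ 2]. Closing the bounded pieces adds only null
    endpoints. *)
Lemma integral_norm_gt_split (R : realType) (g : R -> R) (e Z : R) :
  measurable_fun setT g -> 0 < e -> e < Z ->
  (\int[@lebesgue_measure R]_(z in [set z | (e < `|z|)%R]) (g z)%:E =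
   \int[@lebesgue_measure R]_(z in `]-oo, (- Z)%R]) (g z)%:E +
   \int[@lebesgue_measure R]_(z in `[(- Z)%R, (- e)%R]) (g z)%:E +
   (\int[@lebesgue_measure R]_(z in `[e, Z]) (g z)%:E +
    \int[@lebesgue_measure R]_(z in `[Z, +oo[) (g z)%:E))%E.
Proof.
move=> mg e0 eZ.
have mgD (D : set R) : measurable_fun D (EFin \o g).
  by apply/measurable_EFinP; exact: measurable_funS mg.
have -> : [set z : R | e < `|z|] =
    (`]-oo, - Z] `|` `](- Z), (- e)[) `|` (`]e, Z[ `|` `[Z, +oo[).
  apply/seteqP; split => z /=; rewrite !in_itv/= ?andbT lter_normr.
    move=> /orP[ez|ez].
      by case: (ltP z Z) => zZ; right; [left; rewrite ez | right].
    by case: (leP z (- Z)) => zZ; left; [left | right; rewrite ltrNr].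
  move=> [[H|/andP[_ H]]|[/andP[H _]|H]]; apply/orP; lra.
have mI (i : interval R) : measurable [set` i] by exact: measurable_itv.
have splitU (A B : set R) : measurable A -> measurable B ->
    (forall z, A z -> B z -> False) ->
    (\int[@lebesgue_measure R]_(z in A `|` B) (g z)%:E =
     \int[@lebesgue_measure R]_(z in A) (g z)%:E +
     \int[@lebesgue_measure R]_(z in B) (g z)%:E)%E.
  move=> mA mB AB; apply: integral_setU => //; first exact: mgD.
  by apply/disj_setPS => z [/AB H /H].
rewrite splitU; last 3 first.
- exact: measurableU.
- exact: measurableU.
- move=> z /=; rewrite !in_itv/= ?andbT.
  by move=> [H|/andP[_ H]] [/andP[K _]|K]; lra.
rewrite splitU//; last first.
  by move=> z /=; rewrite !in_itv/= => H /andP[K _]; lra.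
rewrite splitU//; last first.
  by move=> z /=; rewrite !in_itv/= ?andbT => /andP[_ H] K; lra.
congr (_ + _ + (_ + _))%E.
  exact: (esym (@integral_itv_bndoo R _ _ (EFin \o g) true false _)).
exact: (esym (@integral_itv_bndoo R _ _ (EFin \o g) true false _)).
Qed.

(** Cut the truncated integral at distance [Z] from [x]. Each tail contributes [- f x / Z], as [f]
    vanishes there, and the bounded pieces give differences of [V]. Since
    [V (x + Z) - V (x - Z) = 2 * f x / Z], the tails cancel and exactly [V (x - e) - V (x + e)] is
    left. *)
Lemma half_laplacian_of_primitive (R : realType) (f V : R -> R) (x rho : R) :
  continuous f -> 0 <= f x -> `|x| < rho ->
  (forall y, rho <= `|y| -> f y = 0) ->
  (forall y : R, y != x -> is_derive y 1 V ((f y - f x) / (y - x) ^+ 2)) ->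
  (forall y, rho <= `|y| -> V y = f x / (y - x)) ->
  V (x - e) - V (x + e) @[e --> 0^'+] --> 0 ->
  half_laplacian f x 0.
Proof.
move=> cf fx0 xrho fout dV Vout limV.
pose g z := (f (x + z) - f x) / `|z| ^+ 2.
(* With this radius, [Z <= |z|] forces [rho <= |x + z|], where [f] and [V] are explicit. *)
pose Z := rho + `|x|.
have rho0 : 0 < rho by rewrite (le_lt_trans _ xrho).
have Z0 : 0 < Z by rewrite /Z ltr_pwDl.
have mg : measurable_fun setT g.
  apply: measurable_funM.
    apply: measurable_funB => //; apply: continuous_measurable_fun => z.
    by apply: continuous_comp; [exact: (cvgD (cvg_cst _) cvg_id) | exact: cf].
  apply: (measurableT_comp (@measurable_inv R)).
  by apply: measurable_funX; exact: normr_measurable.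
have far z : Z <= `|z| -> rho <= `|x + z|.
  rewrite /Z => Zz; rewrite -lerBrDr in Zz; apply: le_trans Zz _.
  have := ler_normD (x + z) (- x); rewrite addrAC subrr add0r normrN.
  by rewrite lerBlDr.
have gfar z : Z <= `|z| -> (g z)%:E = (- (f x / z ^+ 2)%:E)%E.
  by move=> /far/fout fz; rewrite /g fz sub0r mulNr real_normK// num_real.
have dVz (z : R) : z != 0 -> is_derive z 1 (fun z => V (x + z)) (g z).
  move=> z0; have dVxz : is_derive (x + z) 1 V (g z).
    rewrite /g real_normK ?num_real//.
    have := dV (x + z); rewrite addrAC subrr add0r; apply.
    by rewrite -subr_eq0 addrAC subrr add0r.
  have -> : (fun z => V (x + z)) = V \o (cst x + id) by [].
  by apply: is_derive_eq; rewrite add0r mulr1.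
have cVz (z : R) : z != 0 -> {for z, continuous (fun z => V (x + z))}.
  move=> /dVz; exact: is_derive_continuous.
have cg (z : R) : z != 0 -> {for z, continuous g}.
  move=> z0; apply: cvgM.
    apply: cvgB; last exact: cvg_cst.
    by apply: continuous_comp; [exact: (cvgD (cvg_cst _) cvg_id) | exact: cf].
  apply: cvgV; first by rewrite expf_neq0// normr_eq0.
  apply: (@continuous_comp _ _ _ (fun z : R => `|z|) (fun z => z ^+ 2)).
    exact: norm_continuous.
  exact: exprn_continuous.
have piece a b : a < b -> (forall z, a <= z <= b -> z != 0) ->
    (\int[@lebesgue_measure R]_(z in `[a, b]) (g z)%:E
      = (V (x + b) - V (x + a))%:E)%E.
  move=> ab ab0.
  rewrite (@continuous_FTC2 R g (fun z => V (x + z)))//.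
  - apply: continuous_in_subspaceT => z; rewrite inE/= in_itv/= => zab.
    exact/cg/ab0.
  - split.
    + move=> z; rewrite in_itv/= => /andP[az zb].
      by have := dVz z (ab0 _ _) => /(_ ltac:(lra)) ?; exact: ex_derive.
    + by apply: cvg_at_right_filter; apply: cVz; apply: ab0; lra.
    + by apply: cvg_at_left_filter; apply: cVz; apply: ab0; lra.
  - move=> z; rewrite in_itv/= => /andP[az zb].
    have := dVz z (ab0 _ _) => /(_ ltac:(lra)) ?.
    by rewrite derive1E; exact: derive_val.
have truncated e : 0 < e -> e < Z ->
    (\int[@lebesgue_measure R]_(z in [set z | (e < `|z|)%R]) (g z)%:E
      = (V (x - e) - V (x + e))%:E)%E.
  move=> e0 eZ.
  rewrite (integral_norm_gt_split mg e0 eZ).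
  rewrite piece; [|by lra|by move=> z zz; apply/eqP; lra].
  rewrite piece; [|by lra|by move=> z zz; apply/eqP; lra].
  have tail (D : set R) : (forall z, D z -> Z <= `|z|) ->
      (\int[@lebesgue_measure R]_(z in D) (f x / z ^+ 2)%:E = (f x / Z)%:E ->
      \int[@lebesgue_measure R]_(z in D) (g z)%:E = (- (f x / Z))%:E)%E.
    move=> DZ tailD.
    transitivity (\int[@lebesgue_measure R]_(z in D) (- (f x / z ^+ 2)%:E))%E.
      by apply: eq_integral => z; rewrite inE => /DZ/gfar.
    rewrite integral_ge0N ?tailD//.
    by move=> z _; rewrite lee_fin divr_ge0// sqr_ge0.
  rewrite (tail `]-oo, - Z]%classic); last 2 first.
  - by move=> z /=; rewrite in_itv/= => zZ; rewrite lter_normr; lra.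
  - exact: integral_inv_sqr_left.
  rewrite (tail `[Z, +oo[%classic); last 2 first.
  - by move=> z /=; rewrite in_itv/= => zZ; rewrite lter_normr; lra.
  - exact: integral_inv_sqr_right.
  rewrite (Vout (x + Z)); last by apply: far; rewrite ger0_norm// ltW.
  rewrite (Vout (x - Z)); last by apply: far; rewrite normrN ger0_norm// ltW.
  have -> : x + Z - x = Z by lra.
  have -> : x - Z - x = - Z by lra.
  by rewrite -!EFinD invrN mulrN; congr EFin; lra.
rewrite /half_laplacian.
have : (pi^-1 * (V (x - e) - V (x + e)))%:E @[e --> 0^'+] --> 0%:E.
  apply: cvg_EFin; first exact: nearW.
  rewrite -[X in _ --> X](mulr0 (pi^-1)); apply: cvgM; [exact: cvg_cst | exact: limV].
apply: cvg_trans; apply: near_eq_cvg; near=> e.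
by rewrite truncated ?EFinM.
Unshelve. all: by end_near. Qed.

(** * The condenser potential *)

(* At points where [f] is negative both sides vanish, since [Num.sqrt] is [0]
   there and [x / 0 = 0]. *)
Lemma is_derive_sqrt_comp (R : realType) (f : R -> R) (x l : R) :
  f x != 0 -> is_derive x 1 f l ->
  is_derive x 1 (fun y => Num.sqrt (f y)) (l / (2 * Num.sqrt (f x))).
Proof.
move=> + df; rewrite neq_lt => /orP[fx|fx].
  apply: (@near_eq_is_derive _ _ _ (cst 0)); last first.
    rewrite (ler0_sqrtr (ltW fx)) mulr0 invr0 mulr0; exact: is_derive_cst.
  near=> y; rewrite /= ler0_sqrtr// ltW//; near: y.
  by move/cvgr_lt : (is_derive_continuous df); exact.
have -> : (fun y => Num.sqrt (f y)) = Num.sqrt \o f by [].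
have ds := is_derive1_sqrt fx.
by rewrite mulrC; exact: is_derive1_comp.
Unshelve. all: by end_near. Qed.

Section condenser.
Variable R : realType.
Implicit Types r rho x y : R.

(** The functions [p] and [q] of the overview. As [Num.sqrt] is [0] on negative numbers,
    [inner_root r] vanishes for [|y| <= r] and [outer_root rho] for [rho <= |y|]. *)
Definition inner_root r y := Num.sqrt (y ^+ 2 - r ^+ 2).

Definition outer_root rho y := Num.sqrt (rho ^+ 2 - y ^+ 2).

Lemma is_derive_inner_root r y : y ^+ 2 != r ^+ 2 ->
  is_derive y 1 (inner_root r) (y / inner_root r y).
Proof.
move=> yr; rewrite /inner_root.
have df : is_derive y 1 (fun z : R => z ^+ 2 - r ^+ 2) (2 * y).
  have -> : (fun z : R => z ^+ 2 - r ^+ 2) = (id ^+ 2) - cst (r ^+ 2) by [].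
  by apply: is_derive_eq; rewrite subr0 /= expr1 /GRing.scale/= mulr1.
have := is_derive_sqrt_comp (f := fun z : R => z ^+ 2 - r ^+ 2) _ df.
rewrite subr_eq0 yr => /(_ isT).
by rewrite -mulf_div divff ?mul1r.
Qed.

Lemma is_derive_outer_root rho y : y ^+ 2 != rho ^+ 2 ->
  is_derive y 1 (outer_root rho) (- (y / outer_root rho y)).
Proof.
move=> yr; rewrite /outer_root.
have df : is_derive y 1 (fun z : R => rho ^+ 2 - z ^+ 2) (- (2 * y)).
  have -> : (fun z : R => rho ^+ 2 - z ^+ 2) = cst (rho ^+ 2) - (id ^+ 2) by [].
  by apply: is_derive_eq; rewrite sub0r /= expr1 /GRing.scale/= mulr1.
have := is_derive_sqrt_comp (f := fun z : R => rho ^+ 2 - z ^+ 2) _ df.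
rewrite subr_eq0 eq_sym yr => /(_ isT).
by rewrite mulNr -mulf_div divff ?mul1r.
Qed.

Lemma continuous_inner_root r : continuous (inner_root r).
Proof.
move=> y; apply: continuous_comp; last exact: sqrt_continuous.
by apply: cvgB; [exact: exprn_continuous | exact: cvg_cst].
Qed.

Lemma continuous_outer_root rho : continuous (outer_root rho).
Proof.
move=> y; apply: continuous_comp; last exact: sqrt_continuous.
by apply: cvgB; [exact: cvg_cst | exact: exprn_continuous].
Qed.

Lemma inner_root_gt0 r y : 0 <= r -> r < y -> 0 < inner_root r y.
Proof.
move=> r0 ry; have y0 := le_lt_trans r0 ry.
by rewrite sqrtr_gt0 subr_gt0 ltr_pXn2r// nnegrE ltW.
Qed.

Lemma outer_root_gt0 rho y : 0 <= y -> y < rho -> 0 < outer_root rho y.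
Proof.
move=> y0 yrho; have rho0 := le_lt_trans y0 yrho.
by rewrite sqrtr_gt0 subr_gt0 ltr_pXn2r// nnegrE ltW.
Qed.

(** The boundary values [1] and [0] force [kappa] to be the inverse of the elliptic integral of
    [1 / (p q)] over [(r, rho)]. It can stay a parameter because both sides of the final energy
    comparison are quadratic in [kappa]. *)
Record condenser_potential r rho (kappa : R) (u : R -> R) : Prop :=
  CondenserPotential {
    condenser_inner_gt0 : 0 < r ;
    condenser_inner_lt : r < rho ;
    condenser_flux_gt0 : 0 < kappa ;
    condenser_continuous : continuous u ;
    condenser_even : forall y, u (- y) = u y ;
    condenser_inner : forall y, `|y| <= r -> u y = 1 ;
    condenser_outer : forall y, rho <= `|y| -> u y = 0 ;
    condenser_derive : forall y, r < y -> y < rho ->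
      is_derive y 1 u (- (kappa / (inner_root r y * outer_root rho y))) }.

(* The substitution s = p / (m + q), m^2 = rho^2 - r^2, turns the improper
   integral of 1 / (p q) over (r, rho) into that of the continuous function [k]
   over (0, 1), and its expression [S] below is constant off that interval. *)
Lemma condenser_potential_exists r rho : 0 < r -> r < rho ->
  exists kappa u, condenser_potential r rho kappa u.
Proof.
move=> r0 rrho.
have rho0 : 0 < rho by exact: lt_trans rrho.
have sqrr : r ^+ 2 < rho ^+ 2 by rewrite ltr_pXn2r// nnegrE ltW.
pose m := outer_root rho r.
have m0 : 0 < m by rewrite sqrtr_gt0 subr_gt0.
have m2 : m ^+ 2 = rho ^+ 2 - r ^+ 2 by rewrite sqr_sqrtr// subr_ge0 ltW.
pose q := outer_root rho.
have q0 y : 0 <= q y by exact: sqrtr_ge0.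
(* The radicand is [p ^ 2] between the plates. Unlike [p ^ 2] it stays equal to [m ^ 2] beyond
   [rho], and it is nonpositive for [|y| <= r], so [S] is [1] and [0] there. *)
pose S y := Num.sqrt (m ^+ 2 - q y ^+ 2) / (m + q y).
(* At [s = S y] between the plates, [1 + s ^ 2 = 2 m / (m + q)], so that
   [D s = (2 m y / (m + q)) ^ 2]. Multiplying [k (S y) = (m + q) / (m y)] by the derivative of [S]
   gives [1 / (p q)]. *)
pose D s := r ^+ 2 * (1 + s ^+ 2) ^+ 2 + 4 * m ^+ 2 * s ^+ 2.
have D0 s : 0 < D s.
  have := mulr_ge0 (sqr_ge0 m) (sqr_ge0 s).
  move=> ms; apply: ltr_pwDl; last by rewrite -mulrA mulr_ge0.
  by rewrite mulr_gt0 ?exprn_gt0// ltr_pwDl// sqr_ge0.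
pose k s := 2 / Num.sqrt (D s).
have k0 s : 0 < k s by rewrite divr_gt0// sqrtr_gt0.
have ck : continuous k.
  move=> s; apply: cvgM; first exact: cvg_cst.
  apply: cvgV; first by rewrite gt_eqF// sqrtr_gt0.
  apply: (@continuous_comp _ _ _ D); last exact: sqrt_continuous.
  have cs2 : {for s, continuous (fun s : R => s ^+ 2)} by exact: exprn_continuous.
  apply: cvgD; last by apply: cvgM; [exact: cvg_cst | exact: cs2].
  apply: cvgM; first exact: cvg_cst.
  by apply: cvg_sqr; apply: cvgD; [exact: cvg_cst | exact: cs2].
have [W dW] := continuous_has_primitive ck.
have cW : continuous W by move=> s; exact: is_derive_continuous (dW s).
pose M := W 1 - W 0.
have M0 : 0 < M.
  have [c _ Mc] := @MVT R W k 0 1 ltr01 (fun s _ => dW s) (continuous_subspaceT cW).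
  by rewrite /M Mc subr0 mulr1.
pose u y := (W 1 - W (S y)) / M.
have cq := @continuous_outer_root rho.
have mq y : 0 < m + q y by rewrite ltr_pwDl.
have cS : continuous S.
  move=> y; apply: cvgM.
    apply: (@continuous_comp _ _ _ (fun y => m ^+ 2 - q y ^+ 2)); last exact: sqrt_continuous.
    apply: cvgB; first exact: cvg_cst.
    by apply: cvg_sqr; exact: cq.
  apply: cvgV; first by rewrite gt_eqF.
  by apply: cvgD; [exact: cvg_cst | exact: cq].
exists M^-1, u; split=> //.
- by rewrite invr_gt0.
- move=> y; apply: cvgM; last exact: cvg_cst.
  apply: cvgB; first exact: cvg_cst.
  by apply: continuous_comp; [exact: cS | exact: cW].
- by move=> y; rewrite /u /S /q /outer_root sqrrN.
- move=> y yr; rewrite /u /S ler0_sqrtr ?mul0r ?divff ?gt_eqF//.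
  have y2 : y ^+ 2 <= r ^+ 2 by rewrite -(real_normK (num_real y)) ler_pXn2r// nnegrE ltW.
  rewrite subr_le0 /q /outer_root sqr_sqrtr ?m2 ?lerD2l ?lerN2//.
  by rewrite subr_ge0 (le_trans y2)// ltW.
- move=> y yrho; have -> : u y = (W 1 - W (S y)) / M by [].
  have qy : q y = 0.
    rewrite /q /outer_root ler0_sqrtr// subr_le0 -(real_normK (num_real y)).
    by rewrite ler_pXn2r// nnegrE ltW.
  by rewrite /S qy expr0n/= subr0 addr0 sqrtr_sqr gtr0_norm// divff ?gt_eqF// subrr mul0r.
move=> y ry yrho.
have y0 : 0 < y by exact: lt_trans ry.
have ry2 : r ^+ 2 < y ^+ 2 by rewrite ltr_pXn2r// nnegrE ltW.
have yrho2 : y ^+ 2 < rho ^+ 2 by rewrite ltr_pXn2r// nnegrE ltW.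
have qy0 : 0 < q y by rewrite sqrtr_gt0 subr_gt0.
have qy2 : q y ^+ 2 = rho ^+ 2 - y ^+ 2 by rewrite sqr_sqrtr// subr_ge0 ltW.
set p := inner_root r y.
have p0 : 0 < p by rewrite sqrtr_gt0 subr_gt0.
have p2 : p ^+ 2 = y ^+ 2 - r ^+ 2 by rewrite sqr_sqrtr// subr_ge0 ltW.
have mqp : m ^+ 2 - q y ^+ 2 = y ^+ 2 - r ^+ 2 by rewrite m2 qy2; lra.
have dq : is_derive y 1 q (- (y / q y)) by apply: is_derive_outer_root; rewrite lt_eqF.
have dn : is_derive y 1 (fun y => Num.sqrt (m ^+ 2 - q y ^+ 2)) (y / p).
  have df : is_derive y 1 (fun y => m ^+ 2 - q y ^+ 2) (2 * y).
    have -> : (fun y => m ^+ 2 - q y ^+ 2) = cst (m ^+ 2) - q ^+ 2 by [].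
    apply: is_derive_eq; rewrite sub0r /= expr1 /GRing.scale/=.
    by field; rewrite gt_eqF.
  have := is_derive_sqrt_comp _ df; rewrite mqp subr_eq0 gt_eqF// => /(_ isT).
  by rewrite -mulf_div divff ?mul1r.
have dS : is_derive y 1 S (y * m / (p * q y * (m + q y))).
  have dm : is_derive y 1 (fun y => m + q y) (- (y / q y)).
    have -> : (fun y => m + q y) = cst m + q by [].
    by apply: is_derive_eq; rewrite add0r.
  have dV := is_deriveV (f := fun y => m + q y) _ dm.
  have {}dV := dV (lt0r_neq0 (mq y)).
  have -> : S = (fun y => Num.sqrt (m ^+ 2 - q y ^+ 2)) * (fun y => (m + q y)^-1) by [].
  apply: is_derive_eq; rewrite mqp -/(inner_root r y) -/p /GRing.scale/=.
  have mq' := lt0r_neq0 (mq y).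
  transitivity (y * (p ^+ 2 + q y * (m + q y)) / (p * q y * (m + q y) ^+ 2)).
    by field; rewrite !gt_eqF.
  (* As [p ^ 2 + q ^ 2 = m ^ 2], one factor [m + q] cancels. *)
  have -> : p ^+ 2 + q y * (m + q y) = m * (m + q y) by rewrite p2 -mqp; ring.
  by field; rewrite !gt_eqF.
have kS : k (S y) = (m + q y) / (m * y).
  rewrite /k; have -> : D (S y) = (2 * m * y / (m + q y)) ^+ 2.
    rewrite /D /S mqp -/(inner_root r y) -/p expr_div_n p2.
    have -> : 1 + (y ^+ 2 - r ^+ 2) / (m + q y) ^+ 2 = 2 * m / (m + q y).
      by rewrite -mqp; field; rewrite gt_eqF.
    by field; rewrite gt_eqF.
  rewrite sqrtr_sqr gtr0_norm ?divr_gt0 ?mulr_gt0//.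
  by field; rewrite !gt_eqF.
have dWS := dW (S y).
have -> : u = M^-1 \*: (cst (W 1) - W \o S).
  by apply/funext => t; rewrite /u /= mulrC.
apply: is_derive_eq; rewrite sub0r kS /GRing.scale/= -/(q y); field.
by rewrite !gt_eqF.
Qed.

End condenser.

Section condenser_potential_theory.
Variables (R : realType) (r rho kappa : R) (u : R -> R).
Implicit Types (x y t : R).
Hypothesis up : condenser_potential r rho kappa u.

Let r0 : 0 < r. Proof. exact: condenser_inner_gt0 up. Qed.

Let rrho : r < rho. Proof. exact: condenser_inner_lt up. Qed.

Let kappa0 : 0 < kappa. Proof. exact: condenser_flux_gt0 up. Qed.

Let rho0 : 0 < rho. Proof. exact: lt_trans rrho. Qed.

(** The mean value theorem gives a point [c] between [x] and [y], where [inner_root r c <= y] and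
    [outer_root rho c <= rho] bound the denominator of the derivative. This yields both the
    monotonicity and the bound on each dyadic scale. *)
Lemma condenser_potential_drop x y : r <= x -> x < y -> y <= rho ->
  kappa * (y - x) / (rho * y) <= u x - u y.
Proof.
have [r0' rrho' rho0'] := And3 r0 rrho rho0.
move=> rx xy yrho.
have du z : z \in `]x, y[ ->
    is_derive z 1 u (- (kappa / (inner_root r z * outer_root rho z))).
  by rewrite in_itv/= => /andP[xz zy]; apply: (condenser_derive up); lra.
have [c] := MVT xy du (continuous_subspaceT (condenser_continuous up)).
rewrite in_itv/= => /andP[xc cy] uc.
have -> : u x - u y = kappa * (y - x) / (inner_root r c * outer_root rho c).
  by rewrite -opprB uc mulNr opprK; ring.
have p0 : 0 < inner_root r c by apply: inner_root_gt0; lra.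
have q0 : 0 < outer_root rho c by apply: outer_root_gt0; lra.
apply: ler_wpM2l; first by rewrite mulr_ge0 ?ltW//; lra.
rewrite lef_pV2 ?posrE ?mulr_gt0//; last lra.
rewrite [leRHS]mulrC; apply: ler_pM; [exact: ltW | exact: ltW | | ].
- apply: (@le_trans _ _ c); last exact: ltW.
  rewrite /inner_root -[leRHS]ger0_norm -?sqrtr_sqr; last lra.
  by rewrite ler_wsqrtr// gerBl sqr_ge0.
- rewrite /outer_root -[leRHS]ger0_norm -?sqrtr_sqr; last lra.
  by rewrite ler_wsqrtr// gerBl sqr_ge0.
Qed.

Lemma condenser_potential_decr x y : r <= x -> x < y -> y <= rho -> u y < u x.
Proof.
have [r0' rrho' rho0'] := And3 r0 rrho rho0.
move=> rx xy yrho; rewrite -subr_gt0.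
apply: lt_le_trans (condenser_potential_drop rx xy yrho).
by rewrite divr_gt0 ?mulr_gt0// ?subr_gt0//; lra.
Qed.

Lemma condenser_potential_norm y : u `|y| = u y.
Proof. by case: ger0P => // _; rewrite (condenser_even up). Qed.

Lemma condenser_potential_r : u r = 1.
Proof. by apply: (condenser_inner up); rewrite gtr0_norm. Qed.

Lemma condenser_potential_rho : u rho = 0.
Proof. by apply: (condenser_outer up); rewrite gtr0_norm. Qed.

Lemma condenser_potential_ge0 y : 0 <= u y.
Proof.
have [yr|ry] := lerP `|y| r; first by rewrite (condenser_inner up).
have [yrho|rhoy] := ltrP `|y| rho; last by rewrite (condenser_outer up).
rewrite -condenser_potential_norm -condenser_potential_rho ltW//.
by apply: condenser_potential_decr => //; exact: ltW.
Qed.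

Lemma condenser_potential_lt1 y : r < `|y| -> u y < 1.
Proof.
move=> ry.
have [yrho|rhoy] := ltrP `|y| rho; last by rewrite (condenser_outer up).
rewrite -condenser_potential_norm -condenser_potential_r.
by apply: condenser_potential_decr => //; exact: ltW.
Qed.

Lemma condenser_potential_le1 y : u y <= 1.
Proof.
have [yr|ry] := lerP `|y| r; first by rewrite (condenser_inner up).
exact/ltW/condenser_potential_lt1.
Qed.

(** The parameter [lambda]: near [r] the derivative is about [- kappa / (sqrt (2 r t) q(r))] at
    [r + t], and integrating [1 / sqrt t] gives the factor [2]. *)
Definition condenser_slope := 2 * kappa / (Num.sqrt (2 * r) * outer_root rho r).

(** L'Hopital's rule against [Num.sqrt t]. The factorisation [p(r + t) = sqrt t * sqrt (2 r + t)]
    isolates the singular factor, which cancels in the quotient of the derivatives. *)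
Lemma condenser_potential_half_derivative :
  (u (r + t) - 1) / Num.sqrt t @[t --> 0^'+] --> - condenser_slope.
Proof.
have [r0' rrho' rho0'] := And3 r0 rrho rho0.
pose df t := - (kappa / (inner_root r (r + t) * outer_root rho (r + t))).
pose dg t := (2 * Num.sqrt t)^-1 : R.
pose s t := - (2 * kappa / (Num.sqrt (2 * r + t) * outer_root rho (r + t))).
have rrho0 : 0 < rho - r by rewrite subr_gt0.
have crt : (r + t) @[t --> (0:R)] --> r.
  by rewrite -[X in _ --> X]addr0; apply: cvgD; [exact: cvg_cst | exact: cvg_id].
have cut : u (r + t) @[t --> (0:R)] --> (1 : R).
  rewrite -condenser_potential_r.
  by apply: (cvg_comp _ _ crt); exact: (condenser_continuous up).
apply: (@lhopital_at_right R (fun t => u (r + t) - 1) df Num.sqrt dg 0 (rho - r)) => //.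
- move=> t; rewrite in_itv/= => /andP[t0 trho].
  have du : is_derive (r + t) 1 u (df t) by apply: (condenser_derive up); lra.
  have -> : (fun t => u (r + t) - 1) = u \o (cst r + id) - cst 1 by [].
  by apply: is_derive_eq; rewrite add0r mulr1 subr0.
- by move=> t; rewrite in_itv/= => /andP[t0 _]; exact: is_derive1_sqrt.
- rewrite -[X in _ --> X](subrr 1); apply: cvgB; last exact: cvg_cst.
  exact: cvg_at_right_filter.
- by apply: cvg_at_right_filter; rewrite -[X in _ --> X]sqrtr0; exact: sqrt_continuous.
- move=> t; rewrite in_itv/= => /andP[t0 _].
  by rewrite /dg invr_neq0// mulf_neq0// gt_eqF// sqrtr_gt0.
have : s t @[t --> 0^'+] --> - condenser_slope.
  apply: cvg_at_right_filter; apply: cvgN; apply: cvgM; first exact: cvg_cst.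
  apply: cvgV.
    by rewrite mulf_neq0// gt_eqF// ?outer_root_gt0 ?sqrtr_gt0 ?mulr_gt0// ltW.
  apply: cvgM.
    have c2rt : 2 * r + t @[t --> (0:R)] --> 2 * r.
      by rewrite -[X in _ --> X]addr0; apply: cvgD; [exact: cvg_cst | exact: cvg_id].
    by apply: (cvg_comp _ _ c2rt); exact: sqrt_continuous.
  by apply: (cvg_comp _ _ crt); exact: continuous_outer_root.
apply: cvg_trans; apply: near_eq_cvg; near=> t.
have t0 : 0 < t by [].
have trho : t < rho - r by near: t; exact: nbhs_right_lt.
rewrite /s /df /dg invrK.
have q0 : 0 < outer_root rho (r + t) by apply: outer_root_gt0; lra.
have -> : inner_root r (r + t) = Num.sqrt t * Num.sqrt (2 * r + t).
  by rewrite -sqrtrM ?ltW// /inner_root; congr Num.sqrt; ring.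
have t20 : 0 < Num.sqrt t by rewrite sqrtr_gt0.
have rt20 : 0 < Num.sqrt (2 * r + t) by rewrite sqrtr_gt0; lra.
by field; rewrite !gt_eqF.
Unshelve. all: by end_near. Qed.

End condenser_potential_theory.

(** * Harmonicity between the plates *)

Section condenser_harmonicity.
Variables (R : realType) (r rho kappa : R) (u : R -> R).
Hypothesis up : condenser_potential r rho kappa u.
Variable x : R.
Hypotheses (rx : r < x) (xrho : x < rho).
Implicit Types (y z : R).

Let r0 : 0 < r. Proof. exact: condenser_inner_gt0 up. Qed.

Let x0 : 0 < x. Proof. exact: lt_trans rx. Qed.

Let p : R -> R := inner_root r.
Let q : R -> R := outer_root rho.
(** The two sides of the fraction inside the logarithm of the overview. [a] is positive everywhere
    and [b] vanishes exactly at [x] and [- x]. *)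
Let a y : R := p y * q x + p x * q y.
Let b y : R := p y * q x - p x * q y.

Let px0 : 0 < p x. Proof. exact: inner_root_gt0 (ltW r0) rx. Qed.

Let qx0 : 0 < q x. Proof. exact: outer_root_gt0 (ltW x0) xrho. Qed.

Let p_eq0 y : `|y| <= r -> p y = 0.
Proof.
move=> yr; rewrite /p /inner_root ler0_sqrtr// subr_le0 -(real_normK (num_real y)).
by rewrite ler_pXn2r// nnegrE ltW.
Qed.

Let q_eq0 y : rho <= `|y| -> q y = 0.
Proof.
move=> yrho; have rho0 : 0 < rho by exact: lt_trans xrho.
rewrite /q /outer_root ler0_sqrtr// subr_le0 -(real_normK (num_real y)).
by rewrite ler_pXn2r// nnegrE ltW.
Qed.

Let p_gt0 y : r < `|y| -> 0 < p y.
Proof.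
by move=> /(inner_root_gt0 (ltW r0)); rewrite /p /inner_root real_normK ?num_real.
Qed.

Let q_gt0 y : `|y| < rho -> 0 < q y.
Proof.
by move=> /(outer_root_gt0 (normr_ge0 y)); rewrite /q /outer_root real_normK ?num_real.
Qed.

Let p_ge0 y : 0 <= p y. Proof. exact: sqrtr_ge0. Qed.

Let q_ge0 y : 0 <= q y. Proof. exact: sqrtr_ge0. Qed.

Let a_gt0 y : 0 < a y.
Proof.
have [yr|ry] := lerP `|y| r.
  by rewrite ltr_wpDl ?mulr_ge0 ?mulr_gt0 ?q_gt0// (le_lt_trans yr)// (lt_trans rx).
by rewrite ltr_pwDl ?mulr_ge0 ?mulr_gt0 ?p_gt0// ltW.
Qed.

Let sqrp y : r < `|y| -> p y ^+ 2 = y ^+ 2 - r ^+ 2.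
Proof. by move=> ry; rewrite sqr_sqrtr// ltW// -sqrtr_gt0 p_gt0. Qed.

Let sqrq y : `|y| < rho -> q y ^+ 2 = rho ^+ 2 - y ^+ 2.
Proof. by move=> yrho; rewrite sqr_sqrtr// ltW// -sqrtr_gt0 q_gt0. Qed.

(** A difference of squares, in which the terms without a factor [rho ^ 2 - r ^ 2] cancel. *)
Let mulab y : r < `|y| -> `|y| < rho ->
  a y * b y = (rho ^+ 2 - r ^+ 2) * (y ^+ 2 - x ^+ 2).
Proof.
move=> ry yrho.
have -> : a y * b y = p y ^+ 2 * q x ^+ 2 - p x ^+ 2 * q y ^+ 2 by rewrite /a /b; ring.
by rewrite !sqrp ?sqrq ?(gtr0_norm x0)//; ring.
Qed.

Let b_neq0 y : y ^+ 2 != x ^+ 2 -> b y != 0.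
Proof.
move=> yx.
have [yr|ry] := lerP `|y| r.
  rewrite /b p_eq0// mul0r sub0r oppr_eq0 mulf_neq0// gt_eqF//.
  by rewrite q_gt0// (le_lt_trans yr)// (lt_trans rx).
have [rhoy|yrho] := lerP rho `|y|.
  by rewrite /b (q_eq0 rhoy) mulr0 subr0 mulf_neq0// gt_eqF// p_gt0.
apply/eqP => b0; have := mulab ry yrho; rewrite b0 mulr0 => /esym/eqP.
rewrite mulf_eq0 !subr_eq0 (negbTE yx) orbF gt_eqF// ltr_pXn2r// ?nnegrE ?ltW//.
  exact: lt_trans xrho.
exact: lt_trans xrho.
Qed.

(** This is [log |a / b|]. Half the logarithm of the square replaces the absolute value, so the
    chain rule applies for either sign of [b]. *)
Let L y : R := ln (a y) - 2^-1 * ln (b y ^+ 2).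

(** On the plates [p y] or [q y] is [0], hence [a = b] or [a = - b]. *)
Let L_eq0 y : `|y| <= r \/ rho <= `|y| -> L y = 0.
Proof.
have half_ln z : 0 < z -> ln z - 2^-1 * ln (z ^+ 2) = 0.
  by move=> z0; rewrite lnXn//; field.
rewrite -(half_ln (a y))// /L; have [yr _|ry [yr|yrho]] := lerP `|y| r.
- by rewrite /a /b p_eq0// !mul0r add0r sub0r sqrrN.
- by [].
by rewrite /a /b (q_eq0 yrho) !mulr0 addr0 subr0.
Qed.

Let ca : continuous a.
Proof.
move=> y; apply: cvgD; apply: cvgM; first exact: continuous_inner_root.
- exact: cvg_cst.
- exact: cvg_cst.
exact: continuous_outer_root.
Qed.

Let cb : continuous b.
Proof.
move=> y; apply: cvgB; apply: cvgM; first exact: continuous_inner_root.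
- exact: cvg_cst.
- exact: cvg_cst.
exact: continuous_outer_root.
Qed.

Let cL y : y ^+ 2 != x ^+ 2 -> {for y, continuous L}.
Proof.
move=> yx; apply: cvgB.
  by apply: (cvg_comp a (@ln R) (@ca y)); exact: continuous_ln.
apply: cvgM; first exact: cvg_cst.
apply: (cvg_comp (fun z => b z ^+ 2) (@ln R) (cvg_sqr _ (@cb y))).
apply: continuous_ln.
by rewrite exprn_even_gt0//= b_neq0.
Qed.

Let db y : y ^+ 2 != r ^+ 2 -> y ^+ 2 != rho ^+ 2 ->
  is_derive y 1 b (q x * (y / p y) + p x * (y / q y)).
Proof.
move=> yr yrho.
have dp : is_derive y 1 p (y / p y) by exact: is_derive_inner_root.
have dq : is_derive y 1 q (- (y / q y)) by exact: is_derive_outer_root.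
have -> : b = (q x \*: p) - (p x \*: q) by apply/funext => z; rewrite /b/= mulrC.
by apply: is_derive_eq; rewrite /GRing.scale/= mulrN opprK.
Qed.

(** The formula also holds on the plates: [L] is constant there, and the right-hand side is [0]
    because its denominator is. *)
Let dL y : y ^+ 2 != r ^+ 2 -> y ^+ 2 != rho ^+ 2 -> y ^+ 2 != x ^+ 2 ->
  is_derive y 1 L (- (2 * p x * q x * y / (p y * q y * (y ^+ 2 - x ^+ 2)))).
Proof.
move=> yr yrho yx.
have dp : is_derive y 1 p (y / p y) by exact: is_derive_inner_root.
have dq : is_derive y 1 q (- (y / q y)) by exact: is_derive_outer_root.
have da : is_derive y 1 a (q x * (y / p y) - p x * (y / q y)).
  have -> : a = (q x \*: p) + (p x \*: q) by apply/funext => z; rewrite /a/= mulrC.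
  by apply: is_derive_eq; rewrite /GRing.scale/= mulrN.
have dby := db yr yrho.
have b0 := b_neq0 yx.
have b20 : 0 < b y ^+ 2 by rewrite exprn_even_gt0.
have dlna : is_derive (a y) 1 (@ln R) (a y)^-1 by exact: is_derive1_ln (a_gt0 y).
have dlnb : is_derive ((b ^+ 2) y) 1 (@ln R) (b y ^+ 2)^-1.
  exact: is_derive1_ln b20.
have dcomp : is_derive y 1 L
    ((q x * (y / p y) - p x * (y / q y)) / a y -
     (q x * (y / p y) + p x * (y / q y)) / b y).
  have -> : L = (@ln R \o a) - (2^-1 \*: (@ln R \o (b ^+ 2))) by [].
  apply: is_derive_eq; rewrite /GRing.scale/= expr1.
  have ay0 := lt0r_neq0 (a_gt0 y).
  set t1 := y / p y; set t2 := y / q y.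
  by field; rewrite b0.
apply: is_derive_eq.
have ay0 := lt0r_neq0 (a_gt0 y).
have [ltyr|ry] := lerP `|y| r.
  rewrite /a /b (p_eq0 ltyr) !(invr0, mul0r, mulr0, add0r, sub0r, oppr0).
  have q0 : q y != 0 by rewrite gt_eqF// q_gt0// (le_lt_trans ltyr)// (lt_trans rx).
  by field; rewrite q0 gt_eqF.
have [rhoy|ltyrho] := lerP rho `|y|.
  rewrite /a /b (q_eq0 rhoy) !(invr0, mul0r, mulr0, addr0, subr0, oppr0).
  have p0 : p y != 0 by rewrite gt_eqF// p_gt0.
  by field; rewrite p0 gt_eqF.
have p0 := lt0r_neq0 (p_gt0 ry).
have q0 := lt0r_neq0 (q_gt0 ltyrho).
have pq2 : p y ^+ 2 + q y ^+ 2 = rho ^+ 2 - r ^+ 2.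
  by rewrite sqrp// sqrq//; ring.
have m0 : rho ^+ 2 - r ^+ 2 != 0.
  rewrite subr_eq0 gt_eqF// ltr_pXn2r// ?nnegrE ?ltW//; exact: lt_trans xrho.
have yx0 : y ^+ 2 - x ^+ 2 != 0 by rewrite subr_eq0.
have ab := mulab ry ltyrho.
(* Over the common denominator [a b] the numerator acquires the factor
   [p ^ 2 + q ^ 2 = rho ^ 2 - r ^ 2], which cancels against the same factor of [a b]. *)
transitivity (- (2 * p x * q x * y * (p y ^+ 2 + q y ^+ 2) / (p y * q y * (a y * b y)))).
  by rewrite /a /b in ay0 b0 *; field; rewrite p0 q0 ay0 b0.
by rewrite ab pq2; field; rewrite p0 q0 m0 yx0.
Qed.

(** One formula for the three regions: on the plates the division by [0] returns the derivative [0]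
    of a constant. *)
Let du y : 0 < y -> y != r -> y != rho ->
  is_derive y 1 u (- (kappa / (p y * q y))).
Proof.
move=> y0; rewrite neq_lt => /orP[yr _|ry].
  rewrite p_eq0 ?gtr0_norm ?ltW// mul0r invr0 mulr0 oppr0.
  apply: (@near_eq_is_derive _ _ _ (cst 1 : R -> R)).
  near=> z; rewrite (condenser_inner up)// ger0_norm; apply: ltW; near: z.
  - exact: lt_nbhsl.
  - exact: lt_nbhsr.
rewrite neq_lt => /orP[yrho|rhoy]; first exact: (condenser_derive up ry yrho).
rewrite q_eq0 ?gtr0_norm ?ltW// mulr0 invr0 mulr0 oppr0.
apply: (@near_eq_is_derive _ _ _ (cst 0 : R -> R)).
near=> z; rewrite (condenser_outer up)// ler_normr; apply/orP; left.
by apply: ltW; near: z; exact: lt_nbhsr.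
Unshelve. all: by end_near. Qed.

(** The function [k] of the overview, that is, [- 1 / (y - x) - 1 / (y + x)]; it is unrelated to the
    set [K] of the free boundary problem. *)
Let K y : R := - (2 * y / (y ^+ 2 - x ^+ 2)).

Let dK y : y != x -> y != - x ->
  is_derive y 1 K ((y - x) ^- 2 + (y + x) ^- 2).
Proof.
move=> yx yNx.
have yx0 : y ^+ 2 - x ^+ 2 != 0.
  by rewrite subr_sqr mulf_neq0// ?subr_eq0// addr_eq0.
have df : is_derive y 1 (fun y : R => y ^+ 2 - x ^+ 2) (2 * y).
  have -> : (fun y : R => y ^+ 2 - x ^+ 2) = (id ^+ 2) - cst (x ^+ 2) by [].
  by apply: is_derive_eq; rewrite subr0 /= expr1 /GRing.scale/= mulr1.
have dV := is_deriveV (f := fun y : R => y ^+ 2 - x ^+ 2) yx0 df.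
have -> : K = - ((2 \*: id) * (fun y : R => (y ^+ 2 - x ^+ 2)^-1)) by [].
apply: is_derive_eq; rewrite /= /GRing.scale/= mulr1.
have y1 : y - x != 0 by rewrite subr_eq0.
have y2 : y + x != 0 by rewrite addr_eq0.
by rewrite subr_sqr; field; rewrite y1 y2.
Qed.

Let cK y : y != x -> y != - x -> {for y, continuous K}.
Proof. by move=> yx yNx; exact: is_derive_continuous (dK yx yNx). Qed.

Let sqr_neq y z : 0 <= y -> 0 <= z -> y != z -> y ^+ 2 != z ^+ 2.
Proof. by move=> y0 z0; rewrite eqrXn2. Qed.

(** Integration by parts: the derivative of the first term is [(u y - u x)] times the paired kernel
    plus [u' K], and the derivative of the logarithmic term is [- u' K]. *)
Let P y : R := (u y - u x) * K y + kappa / (p x * q x) * L y.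

Let dP y : 0 < y -> y != x -> y != r -> y != rho ->
  is_derive y 1 P ((u y - u x) * ((y - x) ^- 2 + (y + x) ^- 2)).
Proof.
move=> y0 yx yr yrho.
have rho0 : 0 < rho by exact: lt_trans xrho.
have dKy : is_derive y 1 K ((y - x) ^- 2 + (y + x) ^- 2).
  by apply: dK => //; rewrite gt_eqF// (lt_trans _ y0)// oppr_lt0.
have duy := du y0 yr yrho.
have dLy := dL (sqr_neq (ltW y0) (ltW r0) yr) (sqr_neq (ltW y0) (ltW rho0) yrho)
  (sqr_neq (ltW y0) (ltW x0) yx).
have -> : P = (u - cst (u x)) * K + (kappa / (p x * q x)) \*: L by [].
apply: is_derive_eq; rewrite subr0 /GRing.scale/= /K.
have -> : (u - cst (u x)) y = u y - u x by [].
rewrite (invfM (p y * q y)); set i := (p y * q y)^-1; set k := _ + (y + x) ^- 2.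
set n := (y ^+ 2 - x ^+ 2)^-1.
by field; rewrite !gt_eqF.
Qed.

Let P_eq y : 0 < y -> y != x -> y <= r \/ rho <= y -> P y = (u y - u x) * K y.
Proof.
by move=> y0 yx yout; rewrite /P L_eq0 ?mulr0 ?addr0// gtr0_norm.
Qed.

Let cP y : 0 <= y -> y != x -> {for y, continuous P}.
Proof.
move=> y0 yx; apply: cvgD; apply: cvgM.
- by apply: cvgB; [exact: (condenser_continuous up) | exact: cvg_cst].
- by apply: cK => //; rewrite gt_eqF// (lt_le_trans _ y0)// oppr_lt0.
- exact: cvg_cst.
- by apply: cL; apply: sqr_neq => //; exact: ltW.
Qed.

(* At [x] both [u] and [b] are differentiable, so the singularity of [P] is
   exactly logarithmic and symmetric about [x]. *)
Let P_singularity : exists2 Q : R -> R, {for x, continuous Q} &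
  \forall y \near x, y != x ->
    P y = Q y - kappa / (p x * q x) / 2 * ln ((y - x) ^+ 2).
Proof.
have rho0 : 0 < rho by exact: lt_trans xrho.
have xr : x != r by rewrite gt_eqF.
have xrho' : x != rho by rewrite lt_eqF.
have dux := du x0 xr xrho'.
have dbx := db (sqr_neq (ltW x0) (ltW r0) xr) (sqr_neq (ltW x0) (ltW rho0) xrho').
(* Caratheodory slopes extract a factor [y - x] from [u y - u x] and from [b y]. The first cancels
   the pole of [K], and the second leaves [ln ((y - x) ^ 2)] plus a continuous term, since [h x] is
   not [0]. *)
have /is_derive1_caratheodory[g [gE cg _]] := dux.
have /is_derive1_caratheodory[h [hE ch hx]] := dbx.
have bx : b x = 0 by rewrite /b mulrC subrr.
have h0 : h x != 0.
  by rewrite hx gt_eqF// addr_gt0// mulr_gt0// divr_gt0.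
exists (fun y => - (g y * (2 * y / (y + x))) +
    kappa / (p x * q x) * (ln (a y) - 2^-1 * ln (h y ^+ 2))).
  apply: cvgD.
    apply: cvgN; apply: cvgM; first exact: cg.
    apply: cvgM; first by apply: cvgM; [exact: cvg_cst | exact: cvg_id].
    apply: cvgV; first by rewrite gt_eqF// addr_gt0.
    by apply: cvgD; [exact: cvg_id | exact: cvg_cst].
  apply: cvgM; first exact: cvg_cst.
  apply: cvgB; first by apply: (cvg_comp a (@ln R) (@ca x)); exact: continuous_ln.
  apply: cvgM; first exact: cvg_cst.
  apply: (cvg_comp (fun z => h z ^+ 2) (@ln R) (cvg_sqr _ ch)).
  by apply: continuous_ln; rewrite exprn_even_gt0.
near=> y => yx.
have y0 : 0 < y by near: y; exact: lt_nbhsr.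
have yx0 : y - x != 0 by rewrite subr_eq0.
have yxp : y + x != 0 by rewrite gt_eqF// addr_gt0.
have bE : b y = h y * (y - x) by rewrite -hE bx subr0.
have hy0 : h y != 0.
  apply/eqP => hy0; have := b_neq0 (sqr_neq (ltW y0) (ltW x0) yx).
  by rewrite bE hy0 mul0r eqxx.
rewrite /P gE /L bE exprMn lnM ?posrE ?exprn_even_gt0// /K subr_sqr.
by field; rewrite yx0 yxp !gt_eqF.
Unshelve. all: by end_near. Qed.

(** [P] integrates the sum of the kernels at [y] and [- y] for positive [y]. Undoing the pairing
    requires only a primitive [W] of the reflected part, which has no singularity: [V] is
    [P - W - C] on the right of [0] and [W - C] on the left. *)
Lemma condenser_potential_primitive : exists V : R -> R,
  [/\ forall y, y != x -> is_derive y 1 V ((u y - u x) / (y - x) ^+ 2),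
      forall y, rho <= `|y| -> V y = u x / (y - x) &
      V (x - e) - V (x + e) @[e --> 0^'+] --> 0].
Proof.
have rho0 : 0 < rho by exact: lt_trans xrho.
have cu := condenser_continuous up.
(* For [y <= 0] this is the integrand itself, for [y >= 0] its reflection; being even, it has an odd
   primitive [W]. *)
pose w y : R := (u y - u x) / (`|y| + x) ^+ 2.
have cw : continuous w.
  move=> y; apply: cvgM.
    by apply: cvgB; [exact: cu | exact: cvg_cst].
  apply: cvgV; first by rewrite expf_neq0// gt_eqF// ltr_wpDl.
  apply: cvg_sqr; apply: cvgD; last exact: cvg_cst.
  exact: norm_continuous.
have [W1 dW1] := continuous_has_primitive cw.
pose W y : R := W1 y - W1 0.
have dW y : is_derive y 1 W (w y).
  have dW1y := dW1 y; have -> : W = W1 - cst (W1 0) by [].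
  by apply: is_derive_eq; rewrite subr0.
have cW : continuous W by move=> y; exact: is_derive_continuous (dW y).
have WN y : W (- y) = - W y.
  have dS z : is_derive z 1 (W + (W \o -%R)) 0.
    have dWz := dW z; have dWNz := dW (- z).
    by apply: is_derive_eq; rewrite mulrN1 /w normrN (condenser_even up) subrr.
  have := @is_derive_0_is_cst R (W + (W \o -%R)) y 0 dS.
  have -> : (W + (W \o -%R)) y = W y + W (- y) by [].
  have -> : (W + (W \o -%R)) 0 = W 0 + W (- 0) by [].
  have W0 : W 0 = 0 by rewrite /W subrr.
  rewrite oppr0 W0 addr0 => /eqP.
  by rewrite addrC addr_eq0 => /eqP.
(* This constant makes [W y + C = u x / (y + x)] beyond [rho], where both sides have the same
   derivative. As [W] is odd, it gives [V] the required form on both sides. *)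
pose C := u x / (rho + x) - W rho.
have Wout y : rho <= y -> W y + C = u x / (y + x).
  rewrite le_eqVlt => /orP[/eqP <-|rhoy]; first by rewrite /C addrC subrK.
  have dG z : z \in `]rho, y[ -> is_derive z 1 (fun t => W t - u x / (t + x)) 0.
    rewrite in_itv/= => /andP[rhoz zy].
    have z0 : 0 < z by exact: lt_trans rhoz.
    have zx0 : z + x != 0 by rewrite gt_eqF// addr_gt0.
    have dz : is_derive z 1 (fun t => t + x) 1.
      have -> : (fun t => t + x) = id + cst x by [].
      by apply: is_derive_eq; rewrite addr0.
    have dV := is_deriveV (f := fun t => t + x) zx0 dz.
    have dWz := dW z.
    have -> : (fun t => W t - u x / (t + x)) = W - (u x \*: (fun t => (t + x)^-1)) by [].
    apply: is_derive_eq; rewrite /w (gtr0_norm z0) (condenser_outer up); last first.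
      by rewrite gtr0_norm// ltW.
    by rewrite /GRing.scale/= mulr1 sub0r mulrN opprK mulNr addNr.
  have cG : {within `[rho, y], continuous (fun t => W t - u x / (t + x))}.
    apply: continuous_in_subspaceT => z; rewrite inE/= in_itv/= => /andP[rhoz _].
    apply: cvgB; first exact: cW.
    apply: cvgM; first exact: cvg_cst.
    apply: cvgV; first by rewrite gt_eqF// addr_gt0// (lt_le_trans rho0).
    by apply: cvgD; [exact: cvg_id | exact: cvg_cst].
  have [c _] := MVT rhoy dG cG; rewrite mul0r => /eqP; rewrite subr_eq0 => /eqP WE.
  by rewrite /C; lra.
pose F y : R := P y - W y - C.
pose G y : R := W y - C.
pose V y : R := if 0 <= y then F y else G y.
have dF y : 0 < y -> y != x -> y != r -> y != rho ->
    is_derive y 1 F ((u y - u x) / (y - x) ^+ 2).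
  move=> y0 yx yr yrho; have dPy := dP y0 yx yr yrho; have dWy := dW y.
  have -> : F = P - W - cst C by [].
  apply: is_derive_eq; rewrite subr0 /w gtr0_norm//; ring.
have cF y : 0 <= y -> y != x -> {for y, continuous F}.
  move=> y0 yx; apply: cvgB; last exact: cvg_cst.
  by apply: cvgB; [exact: cP | exact: cW].
have cquot y : y != x -> {for y, continuous (fun y => (u y - u x) / (y - x) ^+ 2)}.
  move=> yx; apply: cvgM.
    by apply: cvgB; [exact: cu | exact: cvg_cst].
  apply: cvgV; first by rewrite expf_neq0// subr_eq0.
  by apply: cvg_sqr; apply: cvgB; [exact: cvg_id | exact: cvg_cst].
(* At [r] and [rho] the roots are not differentiable, but [F] is continuous and the integrand has a
   limit, so the exception is removable. *)
have dF' y : 0 < y -> y != x -> is_derive y 1 F ((u y - u x) / (y - x) ^+ 2).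
  move=> y0 yx; have [->|yr] := eqVneq y r.
    apply: (@is_derive_removable R F (fun y => (u y - u x) / (y - x) ^+ 2) 0 x).
    - by rewrite in_itv/= r0.
    - by apply: cF; [exact: ltW | rewrite lt_eqF].
    - by apply: cquot; rewrite lt_eqF.
    move=> z; rewrite in_itv/= => /andP[z0 zx] zr; apply: dF => //.
      by rewrite lt_eqF.
    by rewrite lt_eqF// (lt_trans zx).
  have [->|yrho] := eqVneq y rho.
    apply: (@is_derive_removable R F (fun y => (u y - u x) / (y - x) ^+ 2) x (rho + 1)).
    - by rewrite in_itv/= xrho ltrDl ltr01.
    - by apply: cF; [exact: ltW | rewrite gt_eqF].
    - by apply: cquot; rewrite gt_eqF.
    move=> z; rewrite in_itv/= => /andP[xz _] zr; apply: dF => //.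
    - exact: lt_trans xz.
    - by rewrite gt_eqF.
    - by rewrite gt_eqF// (lt_trans rx).
  exact: dF.
have dG y : y <= 0 -> is_derive y 1 G ((u y - u x) / (y - x) ^+ 2).
  move=> y0; have dWy := dW y.
  have -> : G = W - cst C by [].
  apply: is_derive_eq; rewrite subr0 /w ler0_norm//; congr (_ / _); ring.
have FG0 : F 0 = G 0.
  rewrite /F /G /P L_eq0; last by left; rewrite normr0 ltW.
  by rewrite /K mulr0 mul0r oppr0 !mulr0 /W subrr addr0 subrr.
have dV y : y != x -> is_derive y 1 V ((u y - u x) / (y - x) ^+ 2).
  have dV0 z : z != 0 -> z != x -> is_derive z 1 V ((u z - u x) / (z - x) ^+ 2).
    rewrite neq_lt => /orP[z0|z0] zx.
      apply: (@near_eq_is_derive _ _ _ G); last by apply: dG; exact: ltW.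
      near=> t; rewrite /V ifF//; apply/negbTE; rewrite -ltNge.
      by near: t; exact: lt_nbhsl.
    apply: (@near_eq_is_derive _ _ _ F); last exact: dF'.
    near=> t; rewrite /V ifT//; apply: ltW.
    by near: t; exact: lt_nbhsr.
  have [->|y0] := eqVneq y 0; last exact: dV0.
  move=> x0'.
  apply: (@is_derive_removable R V (fun y => (u y - u x) / (y - x) ^+ 2) (-1) x).
  - by rewrite in_itv/= oppr_lt0 ltr01.
  - have cF0 := cF 0 (lexx 0) x0'.
    have cG0 := is_derive_continuous (dG 0 (lexx 0)).
    have V0 : V 0 = F 0 by rewrite /V lexx.
    apply/cvgrPdist_lt => e e0; rewrite V0.
    move/cvgrPdist_lt : cF0 => /(_ _ e0) cF0.
    move/cvgrPdist_lt : cG0 => /(_ _ e0); rewrite -FG0 => cG0.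
    near=> t; rewrite {1}/V; case: ifP => _; by near: t.
  - exact: cquot.
  - by move=> z; rewrite in_itv/= => /andP[_ zx] z0; apply: dV0 => //; rewrite lt_eqF.
exists V; split; first exact: dV.
  move=> y; rewrite ler_normr => yrho.
  have [y0|y0] := lerP 0 y; rewrite /V.
    have {}yrho : rho <= y by case/orP : yrho => // yrho; lra.
    have yx : y != x by rewrite gt_eqF// (lt_le_trans xrho).
    rewrite y0 /F -addrA -opprD Wout// P_eq ?(lt_le_trans rho0)//; last by right.
    rewrite (condenser_outer up) ?ger0_norm// /K subr_sqr.
    by field; rewrite subr_eq0 yx gt_eqF// addr_gt0// (lt_le_trans rho0).
  have {}yrho : rho <= - y by case/orP : yrho => // yrho; lra.
  rewrite leNgt y0/= /G -[y]opprK WN; have := Wout _ yrho.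
  set v := - y => Wv; have -> : W v = u x / (v + x) - C by rewrite -Wv addrK.
  have vx : v + x != 0 by rewrite gt_eqF// addr_gt0// (lt_le_trans rho0).
  have vx' : - v - x != 0 by rewrite -opprD oppr_eq0.
  by field; rewrite vx vx'.
have [Q cQ nearP] := P_singularity.
pose c := kappa / (p x * q x) / 2.
pose T y := Q y - W y.
have cT : {for x, continuous T} by apply: cvgB; [exact: cQ | exact: cW].
have shift (s : R) : (x + s * e) @[e --> 0^'+] --> x.
  apply: cvg_at_right_filter; rewrite -[X in _ --> X]addr0 -[X in _ + X](mulr0 s).
  by apply: cvgD; [exact: cvg_cst | apply: cvgM; [exact: cvg_cst | exact: cvg_id]].
have cTs (s : R) : T (x + s * e) @[e --> 0^'+] --> T x.
  by apply: (cvg_comp _ T (shift s)); exact: cT.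
have : T (x + (-1) * e) - T (x + 1 * e) @[e --> 0^'+] --> 0.
  by rewrite -[X in _ --> X](subrr (T x)); apply: cvgB; exact: cTs.
apply: cvg_trans; apply: near_eq_cvg; near=> e.
have e0 : 0 < e by [].
(* Taking [s = 1] and [s = -1] treats both sides of [x] at once. The logarithm depends on [s] only
   through its square, so it cancels in the difference. *)
have VE (s : R) : s != 0 -> 0 < x + s * e ->
    (x + s * e != x -> P (x + s * e) = Q (x + s * e) - c * ln ((x + s * e - x) ^+ 2)) ->
    V (x + s * e) = T (x + s * e) - c * ln ((s * e) ^+ 2) - C.
  move=> s0 xse0 PE; have xse : x + s * e - x = s * e by rewrite addrAC subrr add0r.
  rewrite /V (ltW xse0) /F PE ?xse /T; first by ring.
  by rewrite -subr_eq0 xse mulf_neq0// gt_eqF.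
have -> : x - e = x + (-1) * e by rewrite mulN1r.
have -> : x + e = x + 1 * e by rewrite mul1r.
have xe0 : 0 < x + 1 * e by rewrite mul1r addr_gt0.
have xNe0 : 0 < x + (-1) * e.
  by rewrite mulN1r subr_gt0; near: e; exact: nbhs_right_lt.
rewrite (VE (-1)) ?oppr_eq0 ?oner_eq0//; last by near: e; exact: (shift (-1) _ nearP).
rewrite (VE 1) ?oner_eq0//; last by near: e; exact: (shift 1 _ nearP).
by rewrite !exprMn sqrrN; ring.
Unshelve. all: by end_near. Qed.

End condenser_harmonicity.

(** * Gagliardo seminorm *)

(** With positions measured from [c], restrict the double integral to [s < x < t] and
    [2 x < y < 3 x]. There [|x - y| <= 2 x], so the integrand is at least [k ^ 2 / (4 x ^ 2)]. The
    range of [y] has length [x], so the inner integral is at least [k ^ 2 / (4 x)], and integrating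
    in [x] gives the logarithm. *)
Lemma Gagliardo_ge_log (R : realType) (f : R -> R) (c s t k : R) :
  continuous f -> 0 < s -> s < t -> 0 <= k ->
  (forall x y, s < x -> x < t -> 2 * x < y -> y < 3 * x ->
    k <= f (c + x) - f (c + y)) ->
  ((k ^+ 2 / 4 * ln (t / s))%:E <= Gagliardo f)%E.
Proof.
move=> cf s0 st k0 kf.
pose F (z : R * R) := ((f z.1 - f z.2) ^+ 2 / `|z.1 - z.2| ^+ 2)%:E.
have mf := continuous_measurable_fun cf.
have mF : measurable_fun [set: R * R] F.
  apply/measurable_EFinP; apply: measurable_funM.
    apply: measurable_funX; apply: measurable_funB.
      by apply: (measurableT_comp mf); exact: measurable_fst.
    by apply: (measurableT_comp mf); exact: measurable_snd.
  apply: (measurableT_comp (@measurable_inv R)); apply: measurable_funX.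
  apply: (measurableT_comp (@normr_measurable R setT)).
  by apply: measurable_funB; [exact: measurable_fst | exact: measurable_snd].
have F0 z : (0 <= F z)%E by rewrite lee_fin divr_ge0 ?sqr_ge0.
have -> : Gagliardo f = (\int[@lebesgue_measure R]_x \int[@lebesgue_measure R]_y F (x, y))%E.
  exact: (@fubini_tonelli1 _ _ _ _ _ (@lebesgue_measure R) (@lebesgue_measure R) F mF F0).
have mH : measurable_fun [set: R] (fun x => \int[@lebesgue_measure R]_y F (x, y))%E.
  exact: (@measurable_fun_fubini_tonelli_F _ _ _ _ _ (@lebesgue_measure R) F mF F0).
have H0 x : (0 <= \int[@lebesgue_measure R]_y F (x, y))%E by exact: integral_ge0.
have inner x : s < x - c -> x - c < t ->
    ((k ^+ 2 / 4 / (x - c))%:E <= \int[@lebesgue_measure R]_y F (x, y))%E.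
  set d := x - c => sd dt; have d0 : 0 < d by exact: lt_trans sd.
  pose I := `](c + 2 * d), (c + 3 * d)[%classic : set R.
  have mI : measurable I by exact: measurable_itv.
  have mFx : measurable_fun [set: R] (fun y => F (x, y)).
    exact: measurableT_comp mF (measurable_pair1 x).
  apply: (@le_trans _ _ (\int[@lebesgue_measure R]_(y in I) F (x, y))%E); last first.
    exact: ge0_subset_integral.
  apply: (@le_trans _ _ (\int[@lebesgue_measure R]_(y in I) ((k / (2 * d)) ^+ 2)%:E)%E).
    have lI : @lebesgue_measure R I = d%:E.
      rewrite /I lebesgue_measure_itv/= lte_fin ifT; last by lra.
      by rewrite -EFinD; congr EFin; lra.
    have -> : (\int[@lebesgue_measure R]_(y in I) ((k / (2 * d)) ^+ 2)%:E =
        ((k / (2 * d)) ^+ 2)%:E * @lebesgue_measure R I)%E by exact: integral_cst.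
    rewrite lI -EFinM lee_fin le_eqVlt; apply/orP; left.
    by apply/eqP; field; rewrite gt_eqF.
  apply: ge0_le_integral => //.
  - by move=> y _; rewrite lee_fin sqr_ge0.
  - exact: measurable_funS mFx.
  move=> y; rewrite /I/= in_itv/= => /andP[yl yr]; rewrite lee_fin.
  have dE : x = c + d by rewrite /d addrC subrK.
  have := kf d (y - c) sd dt; rewrite (addrC c (y - c)) subrK -dE => kxy.
  have {}kxy : k <= f x - f y by apply: kxy; lra.
  have xy0 : 0 < y - x by lra.
  rewrite distrC (gtr0_norm xy0) -expr_div_n.
  have q0 : 0 <= k / (2 * d) by rewrite divr_ge0// mulr_ge0// ltW.
  rewrite ler_sqr ?nnegrE//; last by rewrite divr_ge0//; [lra | exact: ltW].
  apply: ler_pM => //; first by rewrite invr_ge0; lra.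
  by rewrite lef_pV2 ?posrE//; lra.
have -> : (k ^+ 2 / 4 * ln (t / s))%:E =
    (\int[@lebesgue_measure R]_(x in `[(c + s)%R, (c + t)%R]) (k ^+ 2 / 4 / (x - c))%:E)%E.
  have t0 : 0 < t by exact: lt_trans st.
  have dF (x : R) : c + s <= x ->
      is_derive x 1 (fun x => k ^+ 2 / 4 * ln (x - c)) (k ^+ 2 / 4 / (x - c)).
    move=> csx; have xc0 : 0 < x - c by lra.
    have dln := is_derive1_ln xc0.
    have dx : is_derive x 1 (fun x => x - c) 1.
      have -> : (fun x => x - c) = id - cst c by [].
      by apply: is_derive_eq; rewrite subr0.
    have -> : (fun x => k ^+ 2 / 4 * ln (x - c)) =
      (k ^+ 2 / 4) \*: (@ln R \o (fun x => x - c)) by [].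
    by apply: is_derive_eq; rewrite mulr1.
  rewrite (@continuous_FTC2 R _ (fun x => k ^+ 2 / 4 * ln (x - c))).
  - rewrite -EFinB -mulrBr; congr (_ * _)%:E.
    rewrite lnM ?posrE ?invr_gt0// lnV ?posrE//.
    by congr (ln _ - ln _); lra.
  - by rewrite ltrD2l.
  - apply: continuous_in_subspaceT => x; rewrite inE/= in_itv/= => /andP[csx _].
    apply: cvgM; first exact: cvg_cst.
    apply: cvgV; first by rewrite gt_eqF//; lra.
    by apply: cvgB; [exact: cvg_id | exact: cvg_cst].
  - split.
    + move=> x; rewrite in_itv/= => /andP[csx _].
      by have := dF x (ltW csx) => ?; exact: ex_derive.
    + apply: cvg_at_right_filter; exact: (is_derive_continuous (dF _ (lexx _))).
    + apply: cvg_at_left_filter; apply: (is_derive_continuous (dF (c + t) _)).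
      by rewrite lerD2l ltW.
  - move=> x; rewrite in_itv/= => /andP[csx _].
    by have := dF x (ltW csx) => ?; rewrite derive1E; exact: derive_val.
pose J := `]c + s, c + t[%classic : set R.
have mJ : measurable J by exact: measurable_itv.
have mg : measurable_fun J (fun x => (k ^+ 2 / 4 / (x - c))%:E).
  apply/measurable_EFinP; apply: measurable_funM; first exact: measurable_cst.
  apply: (measurableT_comp (@measurable_inv R)).
  by apply: measurable_funB; [exact: measurable_id | exact: measurable_cst].
rewrite (@integral_itv_bndoo R (c + s) (c + t) _ true false)//.
apply: (@le_trans _ _ (\int[@lebesgue_measure R]_(x in J) \int[@lebesgue_measure R]_y F (x, y))%E); last first.
  exact: ge0_subset_integral.
apply: ge0_le_integral => //.
- move=> x; rewrite /J/= in_itv/= => /andP[csx _].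
  by rewrite lee_fin divr_ge0//; [rewrite divr_ge0// sqr_ge0 | lra].
- exact: measurable_funS mH.
by move=> x; rewrite /J/= in_itv/= => /andP[csx xct]; apply: inner; lra.
Qed.

Section condenser_estimates.
Variables (R : realType) (r rho kappa : R) (u : R -> R).
Hypothesis up : condenser_potential r rho kappa u.

Lemma condenser_potential_harmonic (x : R) : r < `|x| -> `|x| < rho ->
  half_laplacian u x 0.
Proof.
move=> rx xrho.
have cu := condenser_continuous up.
have out y : rho <= `|y| -> u y = 0 by exact: (condenser_outer up).
have [V [dV Vout limV]] := condenser_potential_primitive up rx xrho.
case: (ger0P x) => x0.
  rewrite (ger0_norm x0) in dV Vout limV.
  by apply: (half_laplacian_of_primitive (V := V) cu _ xrho) => //;
    exact: (condenser_potential_ge0 up).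
rewrite (ltr0_norm x0) in dV Vout limV.
(* As [u] is even, reflecting the primitive built for [- x] gives one for the negative point [x]. *)
apply: (half_laplacian_of_primitive (V := fun y => - V (- y)) cu _ xrho) => //.
- exact: (condenser_potential_ge0 up).
- move=> y yx.
  have dVy : is_derive (- y) 1 V ((u y - u x) / (y - x) ^+ 2).
    have := dV (- y); rewrite eqr_opp => /(_ yx).
    by rewrite !(condenser_even up) -opprD sqrrN.
  have -> : (fun y => - V (- y)) = - (V \o -%R) by [].
  by apply: is_derive_eq; rewrite mulrN1 opprK.
- move=> y yrho; rewrite Vout ?normrN// (condenser_even up).
  by rewrite -opprD invrN mulrN opprK.
apply: cvg_trans limV; apply: near_eq_cvg; near=> e.
by rewrite !opprD !opprK addrC.
Unshelve. all: by end_near. Qed.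

(** For [y > 2 x] one has [y - x >= y / 2], so [condenser_potential_drop] gives a drop of at least
    [kappa / (2 rho)]. Letting [x] run over [(r, rho / 3)] keeps [y < 3 x] below [rho]. *)
Lemma condenser_Gagliardo_ge (c : R) : 3 * r < rho ->
  (((kappa / rho) ^+ 2 / 16 * ln (rho / (3 * r)))%:E
    <= Gagliardo (fun y => u (y - c)%R))%E.
Proof.
move=> r3.
have [r0 k0 rr] := And3 (condenser_inner_gt0 up) (condenser_flux_gt0 up) (condenser_inner_lt up).
have rho0 : 0 < rho by exact: lt_trans rr.
have -> : (kappa / rho) ^+ 2 / 16 * ln (rho / (3 * r)) =
    (kappa / (2 * rho)) ^+ 2 / 4 * ln (rho / 3 / r).
  have -> : rho / (3 * r) = rho / 3 / r by field; rewrite gt_eqF.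
  by congr (_ * _); field; rewrite gt_eqF.
apply: (@Gagliardo_ge_log R _ c) => //.
- move=> y; apply: (@continuous_comp _ _ _ (fun y => y - c) u); last first.
    exact: (condenser_continuous up).
  by apply: cvgB; [exact: cvg_id | exact: cvg_cst].
- by lra.
- by rewrite divr_ge0// ?mulr_ge0 ?ltW.
move=> x y rx xrho xy yx; rewrite (addrAC c x) (addrAC c y) subrr !add0r.
have y0 : 0 < y by lra.
apply: le_trans (condenser_potential_drop up _ _ _); [|lra|lra|lra].
have -> : kappa / (2 * rho) = kappa * (y / 2) / (rho * y).
  by field; rewrite !gt_eqF.
apply: ler_wpM2r; first by rewrite invr_ge0 ltW// mulr_gt0.
by apply: ler_wpM2l; [exact: ltW | lra].
Qed.

End condenser_estimates.

(** * The free boundary problem *)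

Lemma half_laplacian_shift (R : realType) (f : R -> R) (c x l : R) :
  half_laplacian f (x - c) l -> half_laplacian (fun y => f (y - c)) x l.
Proof.
rewrite /half_laplacian; apply: cvg_trans; apply: near_eq_cvg; near=> e.
by congr (_ * _)%E; apply: eq_integral => z _; rewrite addrAC.
Unshelve. all: by end_near. Qed.

Lemma boundary_itvoo (R : realType) (a b x : R) :
  boundary `]a, b[%classic x -> x = a \/ x = b.
Proof.
move=> [/itv_closure]; rewrite interior_itv_bnd /= !in_itv/= => /andP[ax xb].
move=> /negP; rewrite negb_and -!leNgt => /orP[xa|bx].
  by left; apply/eqP; rewrite eq_le xa ax.
by right; apply/eqP; rewrite eq_le xb bx.
Qed.

(** The unit length leaves only [1] and [-1], and a single point [x - t * n] of the interval
    excludes the inward sign at an endpoint. *)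
Lemma outward_unit_normal_itvoo (R : realType) (a b x n : R) :
  outward_unit_normal `]a, b[%classic x n ->
  (x = a -> n = -1) /\ (x = b -> n = 1).
Proof.
move=> [n1 nearK].
have [t [t0 [Kt _]]] : exists t : R, 0 < t /\
    (`]a, b[%classic (x - t * n) /\ ~ `]a, b[%classic (x + t * n)).
  near (0 : R)^'+ => t; exists t; split=> //.
  by near: t.
move: Kt; rewrite /= in_itv/= => /andP[ax xb].
have [n0|n0] := lerP 0 n.
  rewrite ger0_norm// in n1; rewrite n1 mulr1 in ax xb.
  by split=> xE; [lra | ].
rewrite ltr0_norm// in n1.
have nE : n = -1 by rewrite -n1 opprK.
rewrite nE mulrN1 opprK in ax xb.
by split=> xE //; lra.
Unshelve. all: by end_near. Qed.

(** Contracting [x] slightly towards the centre [c] lands in the open interval. *)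
Lemma closure_itvoo_center (R : realType) (c r x : R) : 0 < r ->
  `|x - c| <= r -> closure `]c - r, c + r[%classic x.
Proof.
move=> r0 xr B Bx.
have cvgx : c + (1 - t) * (x - c) @[t --> (0 : R)^'+] --> x.
  apply: cvg_at_right_filter.
  have xE : c + (1 - 0) * (x - c) = x by rewrite subr0 mul1r addrC subrK.
  rewrite -[X in _ --> X]xE.
  apply: cvgD; first exact: cvg_cst.
  apply: cvgM; last exact: cvg_cst.
  by apply: cvgB; [exact: cvg_cst | exact: cvg_id].
near (0 : R)^'+ => t.
exists (c + (1 - t) * (x - c)); split; last by near: t; exact: (cvgx _ Bx).
have t0 : 0 < t by [].
have t1 : t < 1 by near: t; exact: nbhs_right_lt.
rewrite /= in_itv/= -ltr_distlC opprD addrA subrr sub0r normrN normrM gtr0_norm ?subr_gt0//.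
apply: (@le_lt_trans _ _ ((1 - t) * r)); first by rewrite ler_wpM2l// subr_ge0 ltW.
by rewrite gtr_pMl//; lra.
Unshelve. all: by end_near. Qed.

Section interior_Bernoulli.
Variables (R : realType) (r rho kappa c : R) (u : R -> R).
Hypothesis up : condenser_potential r rho kappa u.

Lemma condenser_slope_gt0 : 0 < condenser_slope r rho kappa.
Proof.
have r0 := condenser_inner_gt0 up.
have m0 := outer_root_gt0 (ltW r0) (condenser_inner_lt up).
have k0 := condenser_flux_gt0 up.
have s0 : 0 < Num.sqrt (2 * r) by rewrite sqrtr_gt0 mulr_gt0.
by rewrite divr_gt0 ?mulr_gt0.
Qed.

Lemma condenser_interior_Bernoulli_solution :
  interior_Bernoulli_solution `]c - rho, c + rho[%classic
    (condenser_slope r rho kappa) (fun y => u (y - c))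
    `]c - r, c + r[%classic.
Proof.
have r0 := condenser_inner_gt0 up; have rr := condenser_inner_lt up.
have clK y : closure `]c - r, c + r[ y -> `|y - c| <= r.
  by move=> /itv_closure/=; rewrite in_itv/= distrC ler_distlC.
split.
- move=> y; apply: (@continuous_comp _ _ _ (fun y => y - c) u); last first.
    exact: (condenser_continuous up).
  by apply: cvgB; [exact: cvg_id | exact: cvg_cst].
- by move=> y; rewrite (condenser_potential_ge0 up) (condenser_potential_le1 up).
- by exists (c - r), (c + r); split=> //; lra.
- by move=> y /=; rewrite !in_itv/= => /andP[cy yc]; lra.
- move=> y; rewrite /= in_itv/= => yD yK.
  apply: half_laplacian_shift; apply: (condenser_potential_harmonic up); last first.
    by rewrite distrC ltr_distlC.
  by rewrite ltNge; apply/negP => yr; apply: yK; exact: closure_itvoo_center.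
- by move=> y /clK yr; rewrite (condenser_inner up).
- move=> y; rewrite /= in_itv/= -ltr_distlC => /negP; rewrite -leNgt => yD.
  by rewrite (condenser_outer up)// distrC.
move=> y n yK yn.
have [nl nr] := outward_unit_normal_itvoo yn.
have y1 : u (y - c) = 1.
  by apply: (condenser_inner up); apply: clK; case: yK.
rewrite /half_normal_derivative y1.
have -> : (fun t => (u (y + t * n - c) - 1) / Num.sqrt t) =
    (fun t => (u (r + t) - 1) / Num.sqrt t).
  apply/funext => t; congr ((_ - _) / _).
  case: (boundary_itvoo yK) => yE.
    (* At the left end [n = -1], and evenness turns the difference quotient into the one at [r]. *)
    by rewrite nl// yE -(condenser_even up); congr u; lra.
  by rewrite nr// yE; congr u; lra.
exact: condenser_potential_half_derivative up.
Qed.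

Lemma condenser_sublevel_measure :
  @lebesgue_measure R [set x | `]c - rho, c + rho[%classic x /\ u (x - c) < 1] =
  (2 * (rho - r))%:E.
Proof.
have r0 := condenser_inner_gt0 up; have rr := condenser_inner_lt up.
have -> : [set x | `]c - rho, c + rho[%classic x /\ u (x - c) < 1] =
    `]c - rho, c - r[%classic `|` `]c + r, c + rho[%classic.
  apply/seteqP; split=> x /=; rewrite !in_itv/=.
    move=> [/andP[xl xr] ux].
    have : r < `|x - c|.
      by rewrite ltNge; apply/negP => /(condenser_inner up) u1; rewrite u1 ltxx in ux.
    by rewrite ltr_normr => /orP[xc|xc]; [right | left]; lra.
  move=> H; split; first by case: H => /andP[xl xr]; lra.
  apply: (condenser_potential_lt1 up); rewrite ltr_normr; apply/orP.
  by case: H => /andP[xl xr]; [right | left]; lra.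
set I := `]c - rho, c - r[%classic; set J := `]c + r, c + rho[%classic.
have -> : @lebesgue_measure R (I `|` J) = (lebesgue_measure I + lebesgue_measure J)%E.
  apply: measureU; [exact: measurable_itv | exact: measurable_itv |].
  apply/seteqP; split=> // x /=.
  by rewrite /I /J /= !in_itv/= => -[/andP[_ xl] /andP[xr _]]; lra.
rewrite /I /J !lebesgue_measure_itv/= !lte_fin !ifT; [|lra|lra].
by rewrite -!EFinD; congr EFin; lra.
Qed.

End interior_Bernoulli.

Lemma zero_admissible (R : realType) (D : set R) : admissible D (cst 0).
Proof.
split; last by apply: aeW => x.
split.
  by apply: (Lfun_addr_closed _ _).1; rewrite lee_fin ler1n.
by rewrite /Gagliardo integral0_eq// => z _ /=; rewrite subrr expr0n mul0r.
Qed.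

Lemma energy_zero (R : realType) (lambda : R) (a b : R) : a < b ->
  energy lambda `]a, b[%classic (cst 0) =
  (Gamma (3 / 2 : R) ^+ 2 * lambda ^+ 2 * (b - a))%:E.
Proof.
move=> ab; rewrite /energy /Gagliardo integral0_eq; last first.
  by move=> z _ /=; rewrite subrr expr0n mul0r.
rewrite mule0 add0e; have -> : [set x | `]a, b[%classic x /\ (cst 0 x : R) < 1] = `]a, b[%classic.
  by apply/seteqP; split=> x /=; [case | move=> ?; split].
by rewrite lebesgue_measure_itv/= lte_fin ab -EFinD -EFinM.
Qed.

Unset Implicit Arguments.

Theorem corollary5p5 (R : realType) (D : set R)
    (hD : bounded_open_interval D) :
  exists (lambda : R) (u : R -> R) (K : set R),
    [/\ 0 < lambda,
        interior_Bernoulli_solution D lambda u K &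
        ~ variational_solution lambda D u].
Proof.
have [a [b [ab ->]]] := hD.
pose c := (a + b) / 2; pose rho := (b - a) / 2.
have rho0 : 0 < rho by rewrite /rho; lra.
have -> : a = c - rho by rewrite /c /rho; field.
have -> : b = c + rho by rewrite /c /rho; field.
pose G := Gamma (3 / 2 : R).
(* [r] is chosen so that [ln (rho / (3 * r)) = N]. With [q = (kappa / rho) ^ 2], the measure term
   gains at most [9 / 2 * G ^ 2 * q], while the seminorm term costs at least [q * N / (32 * pi)];
   these balance at [N = 144 * pi * G ^ 2], and the [+ 1] makes the inequality strict. *)
pose N := 144 * pi * G ^+ 2 + 1.
have N0 : 0 < N by rewrite /N ltr_wpDl// mulr_ge0 ?sqr_ge0// mulr_ge0// pi_ge0.
pose r := rho / 3 * expR (- N).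
have r0 : 0 < r by rewrite /r mulr_gt0 ?expR_gt0//; lra.
have r3 : 3 * r < rho.
  have -> : 3 * r = rho * expR (- N) by rewrite /r; field.
  by rewrite gtr_pMr// expR_lt1 oppr_lt0.
have rr : r < rho by lra.
have lnN : ln (rho / (3 * r)) = N.
  have -> : rho / (3 * r) = expR N.
    have e0 : expR (- N) != 0 by rewrite gt_eqF// expR_gt0.
    rewrite -[RHS]invrK -expRN /r.
    by field; rewrite e0 gt_eqF.
  exact: expRK.
have [kappa [u up]] := condenser_potential_exists r0 rr.
have k0 := condenser_flux_gt0 up.
pose lambda := condenser_slope r rho kappa.
exists lambda, (fun y => u (y - c)), `]c - r, c + r[%classic.
split.
- exact: condenser_slope_gt0 up.
- exact: condenser_interior_Bernoulli_solution.
move=> [_ _ /(_ (cst 0) (zero_admissible _))].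
rewrite energy_zero; last by lra.
apply/negP; rewrite -ltNge /energy -/G (condenser_sublevel_measure c up).
(* The bound [3 * r < rho] gives the factor [8 / 9], which turns [4 * kappa ^ 2 / (rho ^ 2 - r ^ 2)]
   into at most [9 / 2 * (kappa / rho) ^ 2]. *)
have m2 : rho ^+ 2 - r ^+ 2 >= 8 / 9 * rho ^+ 2.
  suff : (3 * r) ^+ 2 <= rho ^+ 2 by rewrite exprMn; lra.
  by rewrite ler_sqr ?nnegrE; lra.
have mr0 : 0 < rho ^+ 2 - r ^+ 2.
  by apply: lt_le_trans m2; rewrite mulr_gt0 ?exprn_gt0//; lra.
have lambda2 : lambda ^+ 2 * (2 * r) = 4 * kappa ^+ 2 / (rho ^+ 2 - r ^+ 2).
  have s0 : 0 < Num.sqrt (2 * r) by rewrite sqrtr_gt0 mulr_gt0.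
  have s2 : Num.sqrt (2 * r) ^+ 2 = 2 * r by rewrite sqr_sqrtr// mulr_ge0// ltW.
  have mE : outer_root rho r ^+ 2 = rho ^+ 2 - r ^+ 2 by rewrite sqr_sqrtr// ltW.
  have m0 : 0 < outer_root rho r by exact: outer_root_gt0 (ltW r0) rr.
  rewrite /lambda /condenser_slope -mE; set s := Num.sqrt _ in s0 s2 *.
  by rewrite -s2; field; rewrite !gt_eqF.
have {}lambda2 : lambda ^+ 2 * (2 * r) <= 9 / 2 * (kappa / rho) ^+ 2.
  rewrite lambda2 ler_pdivrMr// expr_div_n.
  apply: (@le_trans _ _ (9 / 2 * (kappa ^+ 2 / rho ^+ 2) * (8 / 9 * rho ^+ 2))).
    by rewrite le_eqVlt; apply/orP; left; apply/eqP; field; rewrite gt_eqF.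
  by apply: ler_wpM2l => //; rewrite mulr_ge0// divr_ge0 ?sqr_ge0.
have pi0 : 0 < pi :> R by exact: pi_gt0.
have lower := condenser_Gagliardo_ge up c r3.
apply: (@lt_le_trans _ _ (((2 * pi)^-1)%:E * ((kappa / rho) ^+ 2 / 16 * N)%:E +
    (G ^+ 2 * lambda ^+ 2)%:E * (2 * (rho - r))%:E)%E); last first.
  apply: leeD2r; apply: lee_wpmul2l; last by rewrite -lnN.
  by rewrite lee_fin invr_ge0 mulr_ge0 ?ltW.
rewrite -!EFinM -EFinD lte_fin.
have q0 : 0 < (kappa / rho) ^+ 2 by rewrite exprn_gt0// divr_gt0.
set q := (kappa / rho) ^+ 2 in lambda2 q0 *.
have -> : c + rho - (c - rho) = 2 * rho by ring.
(* The measures [2 * rho] and [2 * (rho - r)] differ by [2 * r], the length of [K]; only this gain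
   has to be beaten by the seminorm. *)
suff : G ^+ 2 * (lambda ^+ 2 * (2 * r)) < (2 * pi)^-1 * (q / 16 * N) by lra.
apply: (@le_lt_trans _ _ (G ^+ 2 * (9 / 2 * q))).
  by rewrite ler_wpM2l ?sqr_ge0.
have -> : (2 * pi)^-1 * (q / 16 * N) = G ^+ 2 * (9 / 2 * q) + q / (32 * pi).
  have key (p : R) : p != 0 ->
      (2 * p)^-1 * (q / 16 * (144 * p * G ^+ 2 + 1)) = G ^+ 2 * (9 / 2 * q) + q / (32 * p).
    by move=> p0; field.
  by apply: key; rewrite gt_eqF.
by rewrite ltrDl divr_gt0// mulr_gt0.
Qed.
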